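(* For every $n\in\mathbb{N}$ let $P_n(x)=\sum_{k=0}^n a_{k:n}x^k$ be a real polynomial (not identically zero) of degree at most $n$ with real, nonpositive roots. Suppose that $[\![P_n]\!]_n$ converges weakly, as $n\to\infty$, to some probability measure $\mu$ on $[-\infty,0]$. Then the following hold. (a) Define $\underline m:=\mu(\{0\})$ and $\overline m:=1-\mu(\{-\infty\})$, so that $0\le\underline m\le\overline m\le1$. There exists a strictly concave and infinitely differentiable function $g:(\underline m,\overline m)\to(-\infty,0]$ such that, for all sufficiently small $\varepsilon>0$, $$\sup_{(\underline m+\varepsilon)n\le k\le(\overline m-\varepsilon)n}\left|\frac1n\log\frac{a_{k:n}}{P_n(1)}-g\left(\frac kn\right)\right|\to0\qquad(n\to\infty),$$ as well as $$\sup_{0\le k\le(\underline m-\varepsilon)n}\frac1n\log\frac{a_{k:n}}{P_n(1)}\to-\infty,\qquad\sup_{(\overline m+\varepsilon)n\le k\le n}\frac1n\log\frac{a_{k:n}}{P_n(1)}\to-\infty.\qquad(\mathrm{A})$$ (b) If $\underline m<\overline m$, then the Cauchy transform $G_\mu$ of $\mu$ is such that $(0,+\infty)\ni t\mapsto tG_\mu(t)$ is the inverse of $(\underline m,\overline m)\ni\alpha\mapsto e^{-g'(\alpha)}$. (c) In particular, if $\underline m<\overline m$, then $\lim_{\alpha\to\underline m+}g'(\alpha)=+\infty$ and $\lim_{\alpha\to\overline m-}g'(\alpha)=-\infty$. (d) The function $-g$ is the Legendre transform of $u\mapsto\Psi(e^u)$, i.e. $g(\alpha)=\inf_{u\in\mathbb{R}}(\Psi(e^u)-\alpha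 u)$ for $\alpha\in(\underline m,\overline m)$, where $$\Psi(t)=\int_{(-\infty,0]}\log\left(\frac{t-z}{1-z}\right)\mu(dz),\qquad t>0.$$ (e) Furthermore, for all sufficiently small $\varepsilon>0$, $$\sup_{(\underline m+\varepsilon)n\le k\le(\overline m-\varepsilon)n}\left|\frac{a_{k+1:n}}{a_{k:n}}-e^{g'(k/n)}\right|\to0\qquad(n\to\infty).$$ Moreover, writing $\underline r_n:=\inf\{k\ge0:a_{k:n}\ne0\}$, we have $$\inf_{\underline r_n\le k\le(\underline m-\varepsilon)n}\frac{a_{k+1:n}}{a_{k:n}}\to+\infty\quad\text{and}\quad\inf_{(\overline m+\varepsilon)n\le k<\deg P_n}\frac{a_{k:n}}{a_{k+1:n}}\to+\infty\qquad(n\to\infty).\qquad(\mathrm{B})$$ (f) If $\underline m=\overline m$, then (A) and (B) hold true.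
   Context: Empirical zero distribution: for a polynomial $P\not\equiv0$ with $\deg P\le n$, $$[\![P]\!]_n:=\frac1n\sum_{z\in\mathbb{C}:P(z)=0}\delta_z+\frac{n-\deg P}{n}\delta_\infty,$$ zeros being counted with multiplicity. When all roots are nonpositive, the point $\infty$ is identified with $-\infty$, so $[\![P]\!]_n$ is a probability measure on the compact space $[-\infty,0]$, on which weak convergence is understood. Cauchy transform: for a probability measure $\mu$ on $[-\infty,0]$, $G_\mu(t)=\int_{(-\infty,0]}\frac{\mu(dz)}{t-z}$. Conventions: $\log0=-\infty$; $k$ ranges over integers in all suprema and infima; $\varepsilon>0$ is taken sufficiently small to make the sets over which a supremum or infimum is taken nonempty whenever this is possible (otherwise, a supremum over the empty set is $-\infty$ in (A), an infimum over the empty set is $+\infty$ in (B), and the statement is void). If $\underline m=\overline m$, the interval $(\underline m,\overline m)$ is empty and statements about $g$ are void. *)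

(* Defs.v *)
From HB Require Import structures.
From mathcomp Require Import all_boot all_order all_algebra.
From mathcomp Require Import complex polyrcf.
From mathcomp Require Import all_classical all_reals all_analysis.
From mathcomp Require Import measurable_realfun.

Set Implicit Arguments.
Unset Strict Implicit.
Unset Printing Implicit Defensive.

Import Order.TTheory GRing.Theory Num.Theory.
Import numFieldNormedType.Exports.

Local Open Scope classical_set_scope.
Local Open Scope ring_scope.

(* The compact space [-oo, 0] and its finite part (-oo, 0], as subsets of
   \bar R.  Measures on [-oo, 0] are measures on \bar R giving full mass to
   [nonpos_ext R]. *)
Definition nonpos_ext (R : realType) : set (\bar R) := [set z | (z <= 0)%E].

Definition nonpos_fin (R : realType) : set (\bar R) :=
  [set z | (-oo < z <= 0)%E].

Arguments nonpos_ext R : clear implicits.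
Arguments nonpos_fin R : clear implicits.

(* The order of R[i] is partial: z <= 0 means that z is real and nonpositive. *)
Definition real_nonpos_rooted (R : realType) (p : {poly R}) : Prop :=
  forall z : R[i], root (map_poly (real_complex R) p) z -> z <= 0.

Definition deg (R : realType) (p : {poly R}) : nat := (size p).-1.

(* Smallest k with p`_k != 0 (for p != 0). *)
Definition low_deg (R : realType) (p : {poly R}) : nat :=
  find (fun c => c != 0) p.

(* [rootsR p] lists the distinct real zeros of p, hence all the complex zeros
   when p is [real_nonpos_rooted]; [mup z p] is the multiplicity of z.
   The point at infinity is -oo. *)
Definition zeros_measure (R : realType) (p : {poly R}) :
    {measure set (\bar R) -> \bar R} :=
  msum (fun i : nat => mscale (mup (rootsR p)`_i p)%:R%:nng
                         (dirac ((rootsR p)`_i)%:E))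
       (size (rootsR p)).

Definition zero_distr (R : realType) (n : nat) (p : {poly R}) :
    {measure set (\bar R) -> \bar R} :=
  measure_add (mscale (n%:R^-1)%:nng (zeros_measure p))
              (mscale ((n - deg p)%:R / n%:R)%:nng (dirac -oo%E)).

(* Continuous test functions are bounded, [nonpos_ext R] being compact. *)
Definition weak_cvg (R : realType)
    (mun : nat -> {measure set (\bar R) -> \bar R})
    (mu : {measure set (\bar R) -> \bar R}) : Prop :=
  forall f : \bar R -> R, {within nonpos_ext R, continuous f} ->
    (\int[mun n]_(x in nonpos_ext R) f x) @[n --> \oo] -->
    \int[mu]_(x in nonpos_ext R) f x.

Section limit_objects.
Variables (R : realType) (mu : {measure set (\bar R) -> \bar R}).

Definition mlow : R := fine (mu [set 0%E]).

Definition mhigh : R := 1 - fine (mu [set (-oo)%E]).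

Definition cauchy_transform (t : R) : R :=
  \int[mu]_(z in nonpos_fin R) (t - fine z)^-1.

Definition log_potential (t : R) : R :=
  \int[mu]_(z in nonpos_fin R) ln ((t - fine z) / (1 - fine z)).

End limit_objects.

Definition strictly_concave_on (R : realType) (A : set R) (g : R -> R) : Prop :=
  forall x y t : R, A x -> A y -> x != y -> 0 < t < 1 ->
    t * g x + (1 - t) * g y < g (t * x + (1 - t) * y).

(* A is meant to be open, so that values of g off A play no role. *)
Definition smooth_on (R : realType) (A : set R) (g : R -> R) : Prop :=
  forall (j : nat) (x : R), A x -> derivable (derive1n j g) x 1.

Definition inverse_on (R : realType) (A B : set R) (f h : R -> R) : Prop :=
  [/\ set_fun A B f, set_fun B A h, {in A, cancel f h} & {in B, cancel h f}].

(* [lne] maps 0 to -oo; for real-rooted P n with nonpositive roots, the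
   coefficients and (P n).[1] have the same sign. *)
Definition log_coef (R : realType) (P : nat -> {poly R}) (n k : nat) : \bar R :=
  ((n%:R^-1)%:E * lne ((P n)`_k / (P n).[1])%:E)%E.

(* In the displays below, suprema and infima are taken in \bar R; over the
   empty set they are -oo and +oo respectively.  Real division by 0 is 0; in the
   situation of interest the denominators below are nonzero for n large. *)
Section asymptotics.
Variables (R : realType) (P : nat -> {poly R}).

Definition coef_log_cvg (m M : R) (g : R -> R) : Prop :=
  \forall e \near 0^'+,
    ereal_sup [set `|log_coef P n k - (g (k%:R / n%:R))%:E|%E
              | k in [set k | (m + e) * n%:R <= k%:R <= (M - e) * n%:R]]
      @[n --> \oo] --> 0%E.

Definition coef_log_outside (m M : R) : Prop :=
  \forall e \near 0^'+,
    (ereal_sup [set log_coef P n k | k in [set k | k%:R <= (m - e) * n%:R]]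
       @[n --> \oo] --> -oo%E) /\
    (ereal_sup [set log_coef P n k
               | k in [set k | (M + e) * n%:R <= k%:R /\ (k <= n)%N]]
       @[n --> \oo] --> -oo%E).

Definition coef_ratio_cvg (m M : R) (g : R -> R) : Prop :=
  \forall e \near 0^'+,
    ereal_sup [set (`|(P n)`_k.+1 / (P n)`_k - expR (derive1 g (k%:R / n%:R))|)%:E
              | k in [set k | (m + e) * n%:R <= k%:R <= (M - e) * n%:R]]
      @[n --> \oo] --> 0%E.

Definition coef_ratio_outside (m M : R) : Prop :=
  \forall e \near 0^'+,
    (ereal_inf [set ((P n)`_k.+1 / (P n)`_k)%:E
               | k in [set k | (low_deg (P n) <= k)%N /\
                               k%:R <= (m - e) * n%:R]]
       @[n --> \oo] --> +oo%E) /\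
    (ereal_inf [set ((P n)`_k / (P n)`_k.+1)%:E
               | k in [set k | (M + e) * n%:R <= k%:R /\ (k < deg (P n))%N]]
       @[n --> \oo] --> +oo%E).

End asymptotics.

(* Main.v *)
Require Import Defs.
From mathcomp Require Import all_boot all_order all_algebra.
From mathcomp Require Import complex polyrcf.
From mathcomp Require Import all_classical all_reals all_analysis.
From mathcomp Require Import measurable_realfun.
From mathcomp Require Import ring lra.

(** The normalized polynomial P(x) / P(1) is the product, over the zeros z of P,
    of (x - z) / (1 - z) = (1 - w) + w x, where w = 1 / (1 - z) lies in ]0, 1].
    Each factor generates a Bernoulli law, so the numbers a_k / P(1) are the
    probabilities of a sum of independent Bernoulli variables, and the theorem
    is a local large deviation principle for such sums.  Two facts carry it.

    - The growth rate F_n(u) = (1/n) log (P_n(e^u) / P_n(1)) is the integral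
      over the zero distribution of log ((e^u - z) / (1 - z)).  This function of
      z extends continuously by 0 to z = -oo, so weak convergence gives
      F_n(u) -> Phi(u) = Psi(e^u) for each u
      ([ln_normalize_zero_distr], [continuous_log_test]).

    - The ratios q_(k+1) / q_k of consecutive normalized coefficients do not
      increase with k ([prod_XsubC_ratio_antitone], which are Newton's
      inequalities).  If q_(k+1) e^u >= q_k, the terms q_j e^(uj) increase up to
      the index k+1, so the terms of index > k dominate those before;
      replacing u by v > u multiplies them by at least e^((v-u)(k+1)), whence
      (k+1) (v-u) <= n (F_n(v) - F_n(u)) + log (n+1)   ([pgf_growth_ge]).
      For large n this bounds k/n by a secant slope of Phi to the right of u.
      Therefore q_(k+1) / q_k < e^(-u) as soon as k/n exceeds Phi'(u), and
      symmetrically q_(k+1) / q_k > e^(-u) as soon as k/n is below Phi'(u)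
      ([near_coef_decreasing], [near_coef_increasing]).

    The derivative H(u) = Phi'(u) = e^u G(e^u) is the integral of
    s = e^u / (e^u - z), which increases with u from 1_{z = 0} to 1.  Hence H
    increases from mu{0} = m to 1 - mu{-oo} = M, and when m < M its derivative,
    the integral of s (1 - s), is positive.  Let U be the inverse of H.  The
    squeeze above says that q_(k+1) / q_k is close to e^(-U(k/n)) when k/n is
    inside ]m, M[, and that for n large the ratio exceeds any given bound when
    k/n stays below m, and is below any given positive bound when k/n stays
    above M.

    For the coefficients themselves, Chernoff's bound q_k <= P(e^u) e^(-uk) / P(1)
    gives at most exp (n (Phi(u) - u k/n)) up to the error in F_n.  For u = U(k/n)
    it is sharp up to a subexponential factor, because then q_j e^(uj) is nearly
    maximal at j = k and the n+1 terms add up to P(e^u) / P(1)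
    ([pgf_coef_ge], [near_log_coef]).  So the rate is
    g(a) = Phi(U(a)) - a U(a), the Legendre transform of Phi, and g' = -U.
    Uniformity in k/n on compact subintervals follows from the local statements
    by compactness ([ereal_sup_cvg0]).  Smoothness of g holds because the
    integrals of the powers of s, the functions u and Phi, and 1/H' generate a
    family of functions of u that is closed under differentiation
    ([potential_fun_derive]). *)

Import Order.TTheory GRing.Theory Num.Theory.
Import numFieldNormedType.Exports.

Set Implicit Arguments.
Unset Strict Implicit.
Unset Printing Implicit Defensive.

Local Open Scope classical_set_scope.
Local Open Scope ring_scope.

(** * Factoring a polynomial with nonpositive roots *)

(** The complex roots are real, so the linear factors can be split off one at a
    time without leaving the real polynomials. *)
Lemma real_nonpos_rooted_factor (R : realType) (p : {poly R}) :
  p != 0 -> real_nonpos_rooted p ->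
  exists2 s : seq R, all (<= 0) s &
    p = lead_coef p *: \prod_(x <- s) ('X - x%:P).
Proof.
have [d] := ubnP (size p); elim: d p => // d IH p sp p0 rp.
have [sp1|sp1] := leqP (size p) 1.
  exists [::] => //; rewrite big_nil alg_polyC.
  by rewrite [in LHS](size1_polyC sp1) lead_coefE; case: (size p) sp1 => [|[]].
have /closed_rootP[z rz] : size (map_poly (real_complex R) p) != 1%N.
  by rewrite size_map_poly; case: (size p) sp1 => [|[]].
have z0 := rp _ rz.
have zE : z = (real_complex R) (complex.Re z).
  by case: z z0 {rz} => a b; rewrite lecE /= => /andP[/eqP <- _].
have x0 : complex.Re z <= 0 by move: z0; rewrite lecE => /andP[].
move: rz; rewrite zE fmorph_root => /factor_theorem[q pE].
have q0 : q != 0 by apply: contraNneq p0 => q0; rewrite pE q0 mul0r.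
have [||s s0 qE] := IH q _ q0.
- by move: sp; rewrite pE size_Mmonic ?monicXsubC// size_XsubC addn2 /= ltnS.
- move=> w rw; apply: rp; rewrite pE rmorphM /= rootM rw //.
exists (complex.Re z :: s); first by rewrite /= x0.
rewrite big_cons {1}pE {1}qE pE lead_coef_Mmonic ?monicXsubC//.
by rewrite -scalerAl mulrC.
Qed.

Lemma mup_prod_XsubC (R : realType) (s : seq R) (x : R) :
  mup x (\prod_(y <- s) ('X - y%:P)) = count_mem x s.
Proof.
elim: s => [|y s IH].
  by rewrite big_nil mupNroot// root1.
rewrite big_cons mupM ?polyXsubC_eq0 ?IH //=; last first.
- by apply/monic_neq0/monic_prod_XsubC.
by rewrite -['X - y%:P]expr1 mup_XsubCX eq_sym; case: (y == x).
Qed.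

(** Passes from the sum over distinct roots, weighted by multiplicities, that
    defines [zeros_measure] to the sum over the list of linear factors. *)
Lemma sum_mup_rootsR (R : realType) (c : R) (s : seq R) (F : R -> R) :
  c != 0 ->
  let p := c *: \prod_(x <- s) ('X - x%:P) in
  \sum_(x <- rootsR p) (mup x p)%:R * F x = \sum_(x <- s) F x.
Proof.
move=> c0 p.
have pm x : mup x p = count_mem x s.
  by rewrite /p -mul_polyC mupMr ?mup_prod_XsubC// rootC.
have p0 : p != 0.
  by rewrite scaler_eq0 negb_or c0 monic_neq0// monic_prod_XsubC.
have rp : perm_eq (rootsR p) (undup s).
  apply: uniq_perm; rewrite ?undup_uniq ?uniq_roots// => x.
  have <- := roots_on_rootsR p0.
  by rewrite mem_undup /p rootZ// root_prod_XsubC.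
rewrite (perm_big _ rp) -[RHS]big_undup_iterop_count.
by apply: eq_bigr => x _; rewrite pm mulr_natl Monoid.iteropE;
  elim: count => [|k IH]; rewrite ?mulr0n// mulrS IH.
Qed.

(** * Integrals against the zero distribution *)

Section zero_distr_integral.
Context (R : realType) (n : nat) (c : R) (s : seq R).
Hypotheses (c0 : c != 0) (s0 : all (<= 0) s).
Let p : {poly R} := c *: \prod_(x <- s) ('X - x%:P).

Lemma deg_prod_XsubC : deg p = size s.
Proof. by rewrite /deg size_scale// size_prod_XsubC. Qed.

Lemma measurable_nonpos_ext : measurable (nonpos_ext R).
Proof.
have -> : nonpos_ext R = [set` `]-oo, 0%E]].
  by apply/seteqP; split => x /=; rewrite in_itv.
exact: emeasurable_itv.
Qed.

Local Open Scope ereal_scope.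

(** Additivity of the integral in the measure is cheapest for nonnegative
    integrands; the general case is recovered from positive and negative
    parts. *)
Let ge0_integral_zero_distr (f : \bar R -> R) :
  measurable_fun (nonpos_ext R) (EFin \o f) -> (forall x, (0 <= f x)%R) ->
  \int[zero_distr n p]_(x in nonpos_ext R) (f x)%:E =
  (n%:R^-1 * (\sum_(x <- s) f x%:E) + (n - size s)%:R / n%:R * f -oo%E)%:E.
Proof.
move=> mf f0.
have mD := measurable_nonpos_ext.
have f0' (x : \bar R) : nonpos_ext R x -> 0 <= (f x)%:E by rewrite lee_fin.
rewrite /zero_distr ge0_integral_measure_add// ?ge0_integral_mscale//.
rewrite ge0_integral_measure_sum//.
rewrite integral_dirac// diracE mem_set ?mul1e ?/nonpos_ext/= ?leNye//.
rewrite deg_prod_XsubC EFinD !EFinM; congr (_ + _); congr (_ * _).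
rewrite -(sum_mup_rootsR s (fun x => f x%:E) c0) -/p.
rewrite (big_nth 0%R) big_mkord -sumEFin; apply: eq_bigr => i _.
rewrite ge0_integral_mscale// integral_dirac// diracE mem_set ?mul1e//.
rewrite /nonpos_ext/= lee_fin.
have : (rootsR p)`_i \in rootsR p by exact: mem_nth.
have <- : _ = (_ \in rootsR p) := roots_on_rootsR _ _.
  by move=> /andP[_]; rewrite /p rootZ// root_prod_XsubC => /(allP s0).
by rewrite scaler_eq0 negb_or c0 monic_neq0// monic_prod_XsubC.
Qed.

Lemma Rintegral_zero_distr (f : \bar R -> R) :
  measurable_fun (nonpos_ext R) (EFin \o f) ->
  (\int[zero_distr n p]_(x in nonpos_ext R) f x =
  n%:R^-1 * (\sum_(x <- s) f x%:E) + (n - size s)%:R / n%:R * f -oo%E)%R.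
Proof.
move=> mf; rewrite /Rintegral integralE.
have mf' : measurable_fun (nonpos_ext R) f by exact/measurable_EFinP.
have -> : (fun x => (f x)%:E)^\+ = EFin \o (fun x => Num.max (f x) 0%R).
  by apply/funext => x; rewrite funeposE /= EFin_max.
have -> : (fun x => (f x)%:E)^\- = EFin \o (fun x => Num.max (- f x)%R 0%R).
  by apply/funext => x; rewrite funenegE /= EFin_max.
rewrite !ge0_integral_zero_distr; first last.
- by move=> x; rewrite le_max lexx orbT.
- by apply/measurable_EFinP; exact: measurable_maxr.
- by move=> x; rewrite le_max lexx orbT.
- by apply/measurable_EFinP; apply: measurable_maxr => //; exact: measurable_funN.
have maxB (y : R) : (Num.max y 0 - Num.max (- y) 0 = y)%R.
  case: (lerP 0%R y) => y0; first by rewrite max_r ?subr0// oppr_le0.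
  by rewrite max_l ?sub0r ?opprK// oppr_ge0 ltW.
rewrite -EFinB /= opprD addrACA -!mulrBr maxB -sumrB.
by congr (_ * _ + _)%R; apply: eq_bigr => x _; rewrite maxB.
Qed.

End zero_distr_integral.

(** * Newton's inequalities *)

(** Cross-multiplied so that zero entries need no special care.  Taking all
    i <= j, and not just j = i + 1, also forbids zeros between two positive
    entries of a nonnegative sequence. *)
Definition ratio_antitone (R : realType) (a : nat -> R) : Prop :=
  forall i j, (i <= j)%N -> a i * a j.+1 <= a i.+1 * a j.

Lemma coefXaddC_mul (R : realType) (c : R) (p : {poly R}) (k : nat) :
  (('X + c%:P) * p)`_k = (if k is k'.+1 then p`_k' else 0) + c * p`_k.
Proof. by rewrite mulrDl coefD coefCM coefXM; case: k. Qed.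

(** The 2 x 2 minors of the product are combinations, with coefficients
    1, c and c^2, of minors of the sequence of [p] or of products of its
    entries.  The only minor that is not directly of the assumed form,
    p_(i+2) p_j - p_i p_(j+2), is nonnegative by applying the hypothesis
    twice. *)
Lemma ratio_antitone_mul (R : realType) (c : R) (p : {poly R}) : 0 <= c ->
  (forall k, 0 <= p`_k) -> ratio_antitone (fun k => p`_k) ->
  ratio_antitone (fun k => (('X + c%:P) * p)`_k).
Proof.
move=> c0 p0 rp i j ij; rewrite !coefXaddC_mul.
have pp a b : 0 <= p`_a * p`_b by rewrite mulr_ge0.
case: i ij => [|i] ij.
  case: j ij => [|j] _ /=; rewrite ?add0r; first by rewrite mulrC.
  have := mulr_ge0 (sqr_ge0 c) (_ : 0 <= p`_1 * p`_j.+1 - p`_0 * p`_j.+2).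
  rewrite subr_ge0 => /(_ (rp 0%N j.+1 isT)).
  have := pp 0%N j; have := mulr_ge0 c0 (pp 1%N j).
  lra.
case: j ij => [//|j] ij.
have h1 : 0 <= p`_i.+1 * p`_j - p`_i * p`_j.+1 by rewrite subr_ge0; exact: rp.
have h2 : 0 <= p`_i.+2 * p`_j.+1 - p`_i.+1 * p`_j.+2.
  by rewrite subr_ge0; exact: (rp i.+1 j.+1).
have h3 : 0 <= p`_i.+2 * p`_j - p`_i * p`_j.+2.
  rewrite subr_ge0; have [->|ij'] := eqVneq i j; first by rewrite mulrC.
  have h : (i.+1 <= j)%N by rewrite ltn_neqAle ij'.
  by apply: le_trans (rp i j.+1 _) (rp i.+1 j h); rewrite leqW// ltnW.
have := mulr_ge0 (sqr_ge0 c) h2; have := mulr_ge0 c0 h3.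
lra.
Qed.

Lemma prod_XsubC_ratio_antitone (R : realType) (s : seq R) : all (<= 0) s ->
  let p := \prod_(x <- s) ('X - x%:P) in
  (forall k, 0 <= p`_k) /\ ratio_antitone (fun k => p`_k).
Proof.
elim: s => [|x s IH] /=.
  rewrite big_nil => _; split => [k|i j ij]; rewrite !coef1 ?ler0n//.
  by case: j ij => [|j] _ /=; rewrite !(mulr0, mul0r).
move=> /andP[x0 /IH[p0 rp]]; rewrite big_cons -polyCN.
have nx0 : 0 <= - x by rewrite oppr_ge0.
split; last exact: ratio_antitone_mul.
by move=> k; rewrite coefXaddC_mul addr_ge0 ?mulr_ge0//; case: k.
Qed.

(** * Exponential tilting of the coefficients *)

(** What is used of the generating function of a sum of at most [n] independent
    Bernoulli variables. *)
Definition pgf (R : realType) (n : nat) (q : {poly R}) : Prop :=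
  [/\ (size q <= n.+1)%N, q.[1] = 1, forall k, 0 <= q`_k
    & ratio_antitone (fun k => q`_k)].

Section tilted_terms.
Context (R : realType) (n : nat) (q : {poly R}).
Hypothesis qP : pgf n q.

Let q0 k : 0 <= q`_k. Proof. by case: qP. Qed.

Lemma pgf_coef_gt0 k : q`_k != 0 -> 0 < q`_k.
Proof. by move=> qk; rewrite lt_neqAle eq_sym qk q0. Qed.

(** A zero coefficient below the degree would propagate, through the antitone
    ratios, to all lower ones, down to the lowest nonzero coefficient. *)
Lemma pgf_support k : (low_deg q <= k <= deg q)%N -> 0 < q`_k.
Proof.
case: qP => sq q1 _ rq /andP[lk kd].
have qN0 : q != 0 by apply: contra_eq_neq q1 => ->; rewrite horner0 eq_sym oner_eq0.
have has_q : has (fun c => c != 0) q.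
  apply/(has_nthP 0); exists (size q).-1; first by rewrite prednK ?size_poly_gt0.
  by rewrite -lead_coefE lead_coef_eq0.
have low0 : q`_(low_deg q) != 0 by exact: (nth_find 0 has_q).
have qd : 0 < q`_(deg q) by rewrite pgf_coef_gt0// -lead_coefE lead_coef_eq0.
apply: pgf_coef_gt0; apply: contraNneq low0 => qk.
elim: k lk kd qk => [|k IH]; first by rewrite leqn0 => /eqP -> _ ->.
rewrite leq_eqVlt => /predU1P[-> _ ->//|]; rewrite ltnS => lk kd qk.
apply: IH => //; first exact: ltnW.
case E : (deg q) kd qd => [//|d]; rewrite ltnS => kd qd.
have := rq k d kd; rewrite /= qk mul0r => h; apply/eqP.
by rewrite eq_le q0 andbT -(pmulr_lle0 _ qd).
Qed.

Lemma pgf_low k : (k < low_deg q)%N -> q`_k = 0.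
Proof. by move=> /(before_find 0)/negbFE/eqP. Qed.

Lemma pgf_horner t : q.[t] = \sum_(i < n.+1) q`_i * t ^+ i.
Proof. by case: qP => sq _ _ _; rewrite (horner_coef_wide _ sq). Qed.

Lemma pgf_coef_big k : (n < k)%N -> q`_k = 0.
Proof. by case: qP => sq _ _ _ nk; rewrite nth_default// (leq_trans sq). Qed.

Lemma pgf_term_le t k : 0 < t -> q`_k * t ^+ k <= q.[t].
Proof.
move=> t0; have tm i : 0 <= q`_i * t ^+ i by rewrite mulr_ge0// exprn_ge0// ltW.
have [nk|kn] := ltnP n k.
  by rewrite pgf_coef_big// mul0r pgf_horner sumr_ge0.
rewrite pgf_horner (bigD1 (Ordinal (kn : (k < n.+1)%N)))//= lerDl sumr_ge0//.
Qed.

Lemma pgf_horner_le t c : (forall i, (i <= n)%N -> q`_i * t ^+ i <= c) ->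
  q.[t] <= n.+1%:R * c.
Proof.
move=> h; rewrite pgf_horner -[n.+1 in leRHS]card_ord mulr_natl -sumr_const.
by apply: ler_sum => i _; apply: h; rewrite -ltnS.
Qed.

(** If the value at t > 0 vanished, so would every coefficient, but they add up
    to 1. *)
Lemma pgf_horner_gt0 t : 0 < t -> 0 < q.[t].
Proof.
move=> t0; case: qP => sq q1 _ _.
rewrite ltNge; apply/negP => h.
have z i : (i < n.+1)%N -> q`_i = 0.
  move=> _; apply/eqP; rewrite eq_le q0 andbT -(pmulr_lle0 _ (exprn_gt0 i t0)).
  by rewrite mulrC (le_trans _ h)// mulrC pgf_term_le.
have : q.[1] = 0 by rewrite pgf_horner big1// => i _; rewrite z// mul0r.
by rewrite q1 => /eqP; rewrite oner_eq0.
Qed.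

Lemma pgf_increasing_below t k : 0 < t -> q`_k.+1 != 0 -> q`_k <= q`_k.+1 * t ->
  forall i, (i <= k)%N -> q`_i * t ^+ i <= q`_k.+1 * t ^+ k.+1.
Proof.
case: qP => _ _ _ rq t0 /pgf_coef_gt0 qk h.
have step j : (j <= k)%N -> q`_j * t ^+ j <= q`_j.+1 * t ^+ j.+1.
  move=> jk; rewrite exprS mulrA ler_wpM2r ?exprn_ge0 ?(ltW t0)//.
  rewrite -(ler_pM2r qk) (le_trans (rq j k jk))//.
  by rewrite -mulrA [t * _]mulrC ler_wpM2l.
move=> i ik; have -> : k = (i + (k - i))%N by rewrite subnKC.
have : (i + (k - i) <= k)%N by rewrite subnKC.
elim: (k - i)%N => [|d IH] dk; first by rewrite addn0 step// -(addn0 i).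
rewrite addnS in dk *; exact: (le_trans (IH (ltnW dk)) (step _ dk)).
Qed.

Lemma pgf_decreasing_above t k : 0 < t -> q`_k != 0 -> q`_k.+1 * t <= q`_k ->
  forall i, (k <= i)%N -> q`_i * t ^+ i <= q`_k * t ^+ k.
Proof.
case: qP => _ _ _ rq t0 /pgf_coef_gt0 qk h i /subnKC <-.
elim: (i - k)%N => [|d IH]; first by rewrite addn0.
apply: le_trans IH; rewrite addnS exprS mulrA.
rewrite ler_wpM2r ?exprn_ge0 ?(ltW t0)// -(ler_pM2l qk) mulrA.
have := rq k (k + d)%N (leq_addr _ _) => /(ler_wpM2r (ltW t0)) /le_trans; apply.
by rewrite -mulrA [_ * t]mulrC mulrA ler_wpM2r// mulrC.
Qed.

(** By [pgf_increasing_below], each term of q(t) of index at most k is dominated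
    by the term of index k+1; and a term of index j > k grows by the factor
    (s/t)^j >= (s/t)^(k+1) when t is raised to s.  So none of the n+1 terms of
    q(t) exceeds q(s) (t/s)^(k+1). *)
Lemma pgf_growth_ge t s k : 0 < t -> t < s -> q`_k.+1 != 0 ->
  q`_k <= q`_k.+1 * t -> q.[t] * (s / t) ^+ k.+1 <= n.+1%:R * q.[s].
Proof.
move=> t0 ts qk h; have s0 := lt_trans t0 ts.
have st1 : 1 <= s / t by rewrite ler_pdivlMr// mul1r ltW.
have st0 : 0 < (s / t) ^+ k.+1 by rewrite exprn_gt0// divr_gt0.
rewrite -ler_pdivlMr// -mulrA; apply: pgf_horner_le => i _.
have up j : (k < j)%N -> q`_j * t ^+ j <= q.[s] / (s / t) ^+ k.+1.
  move=> kj; rewrite ler_pdivlMr//; apply: le_trans (pgf_term_le j s0).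
  rewrite -mulrA ler_wpM2l// (_ : s ^+ j = t ^+ j * (s / t) ^+ j); last first.
    by rewrite -exprMn mulrC divfK// gt_eqF.
  by rewrite ler_wpM2l ?exprn_ge0 ?(ltW t0)// ler_weXn2l.
have [/up //|ik] := ltnP k i.
exact: (le_trans (pgf_increasing_below t0 qk h ik) (up k.+1 (leqnn _))).
Qed.

(** The mirror image of [pgf_growth_ge]: the terms of index greater than k are
    dominated by the one of index k, and those of index j <= k shrink by at most
    (t/s)^k when t is lowered to s. *)
Lemma pgf_growth_le t s k : 0 < s -> s < t -> q`_k != 0 ->
  q`_k.+1 * t <= q`_k -> q.[t] <= n.+1%:R * ((t / s) ^+ k * q.[s]).
Proof.
move=> s0 st qk h; have t0 := lt_trans s0 st.
have st1 : 1 <= t / s by rewrite ler_pdivlMr// mul1r ltW.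
apply: pgf_horner_le => i _.
have up j : (j <= k)%N -> q`_j * t ^+ j <= (t / s) ^+ k * q.[s].
  move=> jk; apply: (@le_trans _ _ ((t / s) ^+ k * (q`_j * s ^+ j))); last first.
    by rewrite ler_wpM2l ?pgf_term_le// exprn_ge0// ltW// divr_gt0.
  rewrite (_ : t ^+ j = (t / s) ^+ j * s ^+ j); last first.
    by rewrite -exprMn divfK// gt_eqF.
  rewrite mulrCA ler_wpM2r ?ler_weXn2l//.
  by rewrite mulr_ge0// exprn_ge0// ltW.
have [/up //|/ltnW ki] := leqP i k.
exact: (le_trans (pgf_decreasing_above t0 qk h ki) (up k (leqnn _))).
Qed.

Lemma pgf_low_deg_le t s : 0 < t -> t <= s ->
  q.[t] * (s / t) ^+ low_deg q <= q.[s].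
Proof.
move=> t0 ts; have s0 := lt_le_trans t0 ts.
have st1 : 1 <= s / t by rewrite ler_pdivlMr// mul1r.
rewrite !pgf_horner mulr_suml; apply: ler_sum => i _.
have [il|li] := ltnP i (low_deg q); first by rewrite pgf_low// !mul0r.
rewrite (_ : s ^+ i = t ^+ i * (s / t) ^+ i); last first.
  by rewrite -exprMn mulrC divfK// gt_eqF.
by rewrite mulrA ler_wpM2l ?ler_weXn2l// mulr_ge0// exprn_ge0// ltW.
Qed.

Lemma pgf_deg_ge t s : 0 < t -> t <= s ->
  q.[s] <= q.[t] * (s / t) ^+ deg q.
Proof.
move=> t0 ts; have s0 := lt_le_trans t0 ts.
have st1 : 1 <= s / t by rewrite ler_pdivlMr// mul1r.
rewrite !pgf_horner mulr_suml; apply: ler_sum => i _.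
have [di|id] := ltnP (deg q) i.
  by rewrite nth_default ?mul0r//; move: di; rewrite /deg; case: size.
rewrite (_ : s ^+ i = t ^+ i * (s / t) ^+ i); last first.
  by rewrite -exprMn mulrC divfK// gt_eqF.
by rewrite mulrA ler_wpM2l ?ler_weXn2l// mulr_ge0// exprn_ge0// ltW.
Qed.

(** If the consecutive ratio at k lies within a factor [rho] of 1/t, then so does
    every ratio between k and the position of the largest term of q(t), because
    ratios are monotone; hence that largest term exceeds the term of index k by
    at most rho^n. *)
Lemma pgf_coef_ge t rho k : 0 < t -> 1 <= rho -> q`_k != 0 -> q`_k.+1 != 0 ->
  q`_k <= q`_k.+1 * (t * rho) -> q`_k.+1 * (t / rho) <= q`_k ->
  q.[t] <= n.+1%:R * (rho ^+ n * (q`_k * t ^+ k)).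
Proof.
move=> t0 rho1 qk qk1 hup hdn; have rho0 := lt_le_trans ltr01 rho1.
have kn : (k <= n)%N.
  by rewrite leqNgt; apply: contra qk => nk; rewrite pgf_coef_big.
have qt0 : 0 <= q`_k * t ^+ k by rewrite mulr_ge0// exprn_ge0// ltW.
apply: pgf_horner_le => i iN.
have [ki|ik] := leqP k i.
  have := pgf_decreasing_above (divr_gt0 t0 rho0) qk hdn ki.
  rewrite !expr_div_n => h.
  have h2 : q`_i * t ^+ i <= q`_k * t ^+ k * (rho ^+ i / rho ^+ k).
    rewrite [X in _ <= X](_ : _ = q`_k * (t ^+ k / rho ^+ k) * rho ^+ i).
      by rewrite -ler_pdivrMr ?exprn_gt0// -mulrA.
    by field; rewrite ?expf_neq0 ?gt_eqF.
  apply: (le_trans h2); rewrite mulrC ler_wpM2r// ler_pdivrMr ?exprn_gt0//.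
  by rewrite -exprD ler_weXn2l// (leq_trans iN)// leq_addr.
(* here i < k, so the ratio at k - 1 is available *)
have [k' kE] : exists k', k = k'.+1.
  by case: k ik {kn qk qk1 hup hdn qt0} => // k _; exists k.
have tr0 : 0 < t * rho by rewrite mulr_gt0.
have hi : q`_i * (t * rho) ^+ i <= q`_k * (t * rho) ^+ k.
  have qk' : q`_k'.+1 != 0 by rewrite -kE.
  rewrite kE in ik *; apply: pgf_increasing_below => //.
  case: qP => _ _ _ rq; have := rq k' k'.+1 (leqnSn _); rewrite -kE => h.
  rewrite -(ler_pM2r (pgf_coef_gt0 qk1)); apply: (le_trans h).
  by rewrite -mulrA [_ * rho * _]mulrC ler_wpM2l.
rewrite !exprMn !mulrA in hi.
have hh : q`_i * t ^+ i <= q`_i * t ^+ i * rho ^+ i.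
  by rewrite ler_peMr ?exprn_ege1// mulr_ge0// exprn_ge0// ltW.
apply: (le_trans hh); apply: (le_trans hi); rewrite [leRHS]mulrC.
by rewrite ler_wpM2l// ler_weXn2l.
Qed.

End tilted_terms.

(** * Growth rates and ratios of coefficients *)

(** The factor n+1 lost in counting terms does not matter on the exponential
    scale. *)
Lemma ln_succ_negligible (R : realType) (e : R) : 0 < e ->
  \forall n \near \oo, ln (n.+1%:R : R) <= e * n%:R.
Proof.
move=> e0; near=> n.
have n0 : (0 : R) < n%:R by near: n; exact: nbhs_infty_gtr.
have en0 : 0 <= e * n%:R by rewrite mulr_ge0 ?ltW.
rewrite -ler_expR lnK ?posrE ?ltr0n//.
apply: le_trans (expR_ge1Dxn 1 en0); rewrite -natr1 addrC lerD2l ler_pdivlMr//.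
have : 2 / e ^+ 2 < n%:R by near: n; exact: nbhs_infty_gtr.
rewrite ltr_pdivrMr ?exprn_gt0// => /ltW /(ler_wpM2r (ltW n0)).
by rewrite (_ : 2`! = 2)%N//; lra.
Unshelve. all: by end_near. Qed.

(** The secant to the right of u controls the ratios of coefficients, the one to
    its left the lowest nonzero coefficient. *)
Lemma secant_slopes_lt (R : realType) (f : R -> R) (u d b : R) :
  is_derive u 1 f d -> d < b ->
  exists h, [/\ 0 < h, f (u + h) - f u < b * h & f u - f (u - h) < b * h].
Proof.
move=> [df dfE] db.
have /(cvgr_lt) /(_ _ db) : h^-1 *: (f (h *: 1 + u) - f u) @[h --> 0^'] --> d.
  by rewrite -dfE; exact: df.
rewrite /dnbhs /within /= => -[e /= e0 he].
have e20 : 0 < e / 2 by rewrite divr_gt0.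
have e2e : e / 2 < e by rewrite ltr_pdivrMr// ltr_pMr// ltr1n.
exists (e / 2); split=> //.
- have := he (e / 2); rewrite /ball /= sub0r normrN gtr0_norm// gt_eqF// => /(_ e2e isT).
  by rewrite [_ *: 1]mulr1 [_ + u]addrC /GRing.scale /= mulrC ltr_pdivrMr.
- have := he (- (e / 2)); rewrite /ball /= sub0r opprK gtr0_norm//.
  rewrite oppr_eq0 gt_eqF// => /(_ e2e isT).
  rewrite [_ *: 1]mulr1 [- _ + u]addrC /GRing.scale /= invrN mulNr -mulrN opprB.
  by rewrite mulrC ltr_pdivrMr.
Qed.

Lemma secant_slopes_gt (R : realType) (f : R -> R) (u d b : R) :
  is_derive u 1 f d -> b < d ->
  exists h, [/\ 0 < h, b * h < f (u + h) - f u & b * h < f u - f (u - h)].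
Proof.
move=> df bd.
have dNf : is_derive u 1 (- f) (- d) by exact: is_deriveN.
have [|h [h0 h1 h2]] := @secant_slopes_lt _ _ _ _ (- b) dNf.
  by rewrite ltrN2.
by exists h; split => //; move: h1 h2; rewrite /= !fctE; lra.
Qed.

Section coefficient_asymptotics.
Context (R : realType) (Q : nat -> {poly R}) (Phi H : R -> R).
Hypothesis QP : forall n, (0 < n)%N -> pgf n (Q n).
Hypothesis Qcvg : forall u, ln (Q n).[expR u] / n%:R @[n --> \oo] --> Phi u.
Hypothesis PhiD : forall u : R, is_derive u 1 Phi (H u).

Let horner_expR_gt0 n u : (0 < n)%N -> 0 < (Q n).[expR u].
Proof. by move=> n0; apply: (pgf_horner_gt0 (QP n0)); exact: expR_gt0. Qed.

(** Every estimate below contradicts this inequality for a suitable pair of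
    points; the counting error log (n+1) is absorbed in the strict slack. *)
Lemma near_log_growth_lt u v c : Phi v - Phi u < c ->
  \forall n \near \oo, (0 < n)%N /\
    ln n.+1%:R + ln (Q n).[expR v] - ln (Q n).[expR u] < c * n%:R.
Proof.
move=> h; (* one third of the slack for each of F_n(v), F_n(u) and log (n+1) *)
pose d := (c - (Phi v - Phi u)) / 3.
have d0 : 0 < d by rewrite divr_gt0// subr_gt0.
near=> n.
have n0 : (0 < n)%N by near: n; exact: nbhs_infty_gt.
have nR0 : (0 : R) < n%:R by rewrite ltr0n.
split => //.
have h1 : ln (n.+1%:R : R) <= d * n%:R by near: n; exact: ln_succ_negligible.
have h2 : ln (Q n).[expR v] / n%:R < Phi v + d.
  by near: n; apply: (cvgr_lt (Phi v)) => //; rewrite ltrDl.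
have h3 : Phi u - d < ln (Q n).[expR u] / n%:R.
  by near: n; apply: (cvgr_gt (Phi u)) => //; rewrite gtrBl.
rewrite ltr_pdivrMr// in h2; rewrite ltr_pdivlMr// in h3.
have cE : c = Phi v - Phi u + 3 * d by rewrite /d; lra.
by rewrite cE; lra.
Unshelve. all: by end_near. Qed.

(** If this failed at some k >= b n, [pgf_growth_ge] would force a secant slope
    of the growth rate just to the right of u to be at least b, against
    Phi'(u) < b. *)
Lemma near_coef_decreasing u b : H u < b ->
  \forall n \near \oo, forall k, b * n%:R <= k%:R ->
    (Q n)`_k.+1 != 0 -> (Q n)`_k.+1 * expR u < (Q n)`_k.
Proof.
move=> Hu; have [h [h0 hh _]] := secant_slopes_lt (PhiD u) Hu.
near=> n => k bk qk; rewrite ltNge; apply/negP => hk.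
have [n0 ] : (0 < n)%N /\
    ln n.+1%:R + ln (Q n).[expR (u + h)] - ln (Q n).[expR u] < b * h * n%:R.
  by near: n; exact: near_log_growth_lt.
have tv : expR u < expR (u + h) by rewrite ltr_expR ltrDl.
have := pgf_growth_ge (QP n0) (expR_gt0 u) tv qk hk.
rewrite -expRN -expRD addrAC subrr add0r -expRM_natl.
rewrite -ler_ln ?posrE ?mulr_gt0 ?expR_gt0 ?horner_expR_gt0//.
rewrite !lnM ?posrE ?expR_gt0 ?horner_expR_gt0// expRK => h1.
have : b * n%:R * h <= k.+1%:R * h.
  by rewrite ler_wpM2r ?(ltW h0)// (le_trans bk)// ler_nat.
by rewrite ltNge => h2 /negP; apply; lra.
Unshelve. all: by end_near. Qed.

Lemma near_coef_increasing u b : b < H u ->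
  \forall n \near \oo, forall k, k%:R <= b * n%:R ->
    (Q n)`_k != 0 -> (Q n)`_k < (Q n)`_k.+1 * expR u.
Proof.
move=> Hu; have [h [h0 _ hh]] := secant_slopes_gt (PhiD u) Hu.
near=> n => k bk qk; rewrite ltNge; apply/negP => hk.
have [n0 ] : (0 < n)%N /\
    ln n.+1%:R + ln (Q n).[expR (u - h)] - ln (Q n).[expR u] < - (b * h) * n%:R.
  by near: n; apply: near_log_growth_lt; lra.
have tv : expR (u - h) < expR u by rewrite ltr_expR gtrBl.
have := pgf_growth_le (QP n0) (expR_gt0 (u - h)) tv qk hk.
rewrite -expRN -expRD opprB [u + (h - u)]addrC subrK -expRM_natl.
rewrite -ler_ln ?posrE ?mulr_gt0 ?expR_gt0 ?horner_expR_gt0//.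
rewrite !lnM ?posrE ?mulr_gt0 ?expR_gt0 ?horner_expR_gt0// expRK => h1.
have : k%:R * h <= b * n%:R * h by rewrite ler_wpM2r ?(ltW h0).
by rewrite ltNge => h2 /negP; apply; lra.
Unshelve. all: by end_near. Qed.

(** Zeros at the origin make q(e^u) grow at least like e^(u low_deg), so their
    proportion is bounded by any secant slope of the growth rate. *)
Lemma near_low_deg_lt u b : H u < b ->
  \forall n \near \oo, (low_deg (Q n))%:R < b * n%:R.
Proof.
move=> Hu; have [h [h0 _ hh]] := secant_slopes_lt (PhiD u) Hu.
near=> n.
have [n0 ] : (0 < n)%N /\
    ln n.+1%:R + ln (Q n).[expR u] - ln (Q n).[expR (u - h)] < b * h * n%:R.
  by near: n; exact: near_log_growth_lt.
have tv : expR (u - h) <= expR u by rewrite ler_expR gerBl ltW.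
have := pgf_low_deg_le (QP n0) (expR_gt0 (u - h)) tv.
rewrite -expRN -expRD opprB [u + (h - u)]addrC subrK -expRM_natl.
rewrite -ler_ln ?posrE ?mulr_gt0 ?expR_gt0 ?horner_expR_gt0//.
rewrite !lnM ?posrE ?mulr_gt0 ?expR_gt0 ?horner_expR_gt0// expRK => h1.
have : 0 <= ln (n.+1%:R : R) by rewrite ln_ge0// ler1n.
by move=> h2 h3; rewrite -(ltr_pM2r h0); lra.
Unshelve. all: by end_near. Qed.

Lemma near_deg_gt u b : b < H u ->
  \forall n \near \oo, b * n%:R < (deg (Q n))%:R.
Proof.
move=> Hu; have [h [h0 hh _]] := secant_slopes_gt (PhiD u) Hu.
near=> n.
have [n0 ] : (0 < n)%N /\
    ln n.+1%:R + ln (Q n).[expR u] - ln (Q n).[expR (u + h)] < - (b * h) * n%:R.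
  by near: n; apply: near_log_growth_lt; lra.
have tv : expR u <= expR (u + h) by rewrite ler_expR lerDl ltW.
have := pgf_deg_ge (QP n0) (expR_gt0 u) tv.
rewrite -expRN -expRD addrAC subrr add0r -expRM_natl.
rewrite -ler_ln ?posrE ?mulr_gt0 ?expR_gt0 ?horner_expR_gt0//.
rewrite !lnM ?posrE ?mulr_gt0 ?expR_gt0 ?horner_expR_gt0// expRK => h1.
have : 0 <= ln (n.+1%:R : R) by rewrite ln_ge0// ler1n.
by move=> h2 h3; rewrite -(ltr_pM2r h0); lra.
Unshelve. all: by end_near. Qed.

End coefficient_asymptotics.

(** * Profiles of the coefficients *)

(** Division by the value at 1 turns the coefficients into probabilities. *)
Definition normalize (R : realType) (p : {poly R}) : {poly R} := p.[1]^-1 *: p.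

Lemma coef_normalize (R : realType) (p : {poly R}) k :
  (normalize p)`_k = p`_k / p.[1].
Proof. by rewrite coefZ mulrC. Qed.

Section normalize.
Context (R : realType) (p : {poly R}).
Hypothesis p1 : p.[1] != 0.

Lemma deg_normalize : deg (normalize p) = deg p.
Proof. by rewrite /deg size_scale// invr_neq0. Qed.

Lemma low_deg_normalize : low_deg (normalize p) = low_deg p.
Proof.
rewrite /low_deg.
have sp : size (normalize p) = size p by rewrite size_scale// invr_neq0.
have nz k : ((normalize p)`_k != 0) = (p`_k != 0).
  by rewrite coef_normalize mulf_eq0 invr_eq0 (negbTE p1) orbF.
have E : map (fun c => c != 0) (normalize p) = map (fun c => c != 0) p.
  apply: (@eq_from_nth _ false); rewrite !size_map ?sp// => i ip.
  by rewrite !(nth_map 0) ?sp.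
by have := congr1 (find id) E; rewrite !find_map.
Qed.

Lemma ratio_normalize j k :
  (normalize p)`_j / (normalize p)`_k = p`_j / p`_k.
Proof.
rewrite !coef_normalize; have [->|pk] := eqVneq p`_k 0.
  by rewrite mul0r invr0 !mulr0.
by field; rewrite p1 pk.
Qed.

End normalize.

Lemma secant_le (R : realType) (f df : R -> R) (b u v : R) :
  (forall x : R, is_derive x 1 f (df x)) -> u <= v ->
  (forall x, u < x < v -> df x <= b) -> f v - f u <= b * (v - u).
Proof.
move=> Df; rewrite le_eqVlt => /predU1P[-> _|uv hb]; first by rewrite !subrr mulr0.
have [x xuv ->] := @MVT _ f df u v uv (fun x _ => Df x)
  (derivable_within_continuous (fun x _ => @ex_derive _ _ _ _ _ _ _ (Df x))).
by rewrite ler_wpM2r ?subr_ge0 ?(ltW uv)// hb//; move: xuv; rewrite in_itv.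
Qed.

Lemma secant_ge (R : realType) (f df : R -> R) (b u v : R) :
  (forall x : R, is_derive x 1 f (df x)) -> u <= v ->
  (forall x, u < x < v -> b <= df x) -> b * (v - u) <= f v - f u.
Proof.
move=> Df uv hb.
have dNf (x : R) : is_derive x 1 (- f) (- df x) by exact: is_deriveN.
have : (- f) v - (- f) u <= - b * (v - u).
  by apply: (secant_le dNf uv) => x /hb; rewrite lerN2.
by rewrite !fctE; lra.
Qed.

Section profile.
Context (R : realType) (P : nat -> {poly R}) (Phi H : R -> R) (m M : R).
Let Q n := normalize (P n).
Hypothesis P1 : forall n, (0 < n)%N -> (P n).[1] != 0.
Hypothesis QP : forall n, (0 < n)%N -> pgf n (Q n).
Hypothesis Qcvg : forall u, ln (Q n).[expR u] / n%:R @[n --> \oo] --> Phi u.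
Hypothesis PhiD : forall u : R, is_derive u 1 Phi (H u).
Hypothesis Hm : forall u, m <= H u.
Hypothesis HM : forall u, H u <= M.
Hypothesis Phi0 : Phi 0 = 0.

Lemma log_coefE n k : (0 < n)%N -> (Q n)`_k != 0 ->
  log_coef P n k = (ln (Q n)`_k / n%:R)%:E.
Proof.
move=> n0 qk; rewrite /log_coef -coef_normalize lne_EFin ?(pgf_coef_gt0 (QP n0))//.
by rewrite -EFinM mulrC.
Qed.

(** Chernoff's bound. *)
Lemma log_coef_le n k u : (0 < n)%N ->
  (log_coef P n k <= (ln (Q n).[expR u] / n%:R - u * (k%:R / n%:R))%:E)%E.
Proof.
move=> n0; have nR0 : (0 : R) < n%:R by rewrite ltr0n.
have [qk|qk] := eqVneq (Q n)`_k 0.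
  rewrite /log_coef -coef_normalize -/(Q n) qk /lne lexx mulrNy gtr0_sg ?invr_gt0//.
  by rewrite mul1e leNye.
rewrite log_coefE// lee_fin mulrA -mulrBl ler_pM2r ?invr_gt0//.
have q0 := pgf_coef_gt0 (QP n0) qk.
have := pgf_term_le (QP n0) k (expR_gt0 u); rewrite -expRM_natl.
rewrite -ler_ln ?posrE ?(pgf_horner_gt0 (QP n0)) ?mulr_gt0 ?expR_gt0//.
by rewrite lnM ?posrE ?expR_gt0// expRK; lra.
Qed.

(** For k/n <= m - e, Chernoff's bound at the point -u < 0 is at most
    exp (n (1 - u e)), since Phi(-u) <= - m u; and u is arbitrary.  The other side
    is symmetric, with Phi(u) <= M u for u > 0. *)
Lemma coef_log_outsideP : coef_log_outside P m M.
Proof.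
rewrite /coef_log_outside; near=> e.
have e0 : 0 < e by near: e; exact: nbhs_right_gt.
(* with this u, the exponent 1 - u e is - |A| <= A *)
split; apply/cvgeNyPle => A; pose u := (1 + `|A|) / e.
- have ue : u * e = 1 + `|A| by rewrite /u divfK// gt_eqF.
  have u0 : 0 < u by rewrite divr_gt0// ltr_wpDr.
  have Phiu : Phi (- u) <= m * - u.
    have := @secant_ge _ Phi H m (- u) 0 PhiD; rewrite Phi0 !sub0r opprK oppr_le0.
    by move=> /(_ (ltW u0) (fun x _ => Hm x)); rewrite mulrN; lra.
  near=> n; have n0 : (0 < n)%N by near: n; exact: nbhs_infty_gt.
  have nR0 : (0 : R) < n%:R by rewrite ltr0n.
  have Fn : ln (Q n).[expR (- u)] / n%:R < Phi (- u) + 1.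
    by near: n; apply: (cvgr_lt (Phi (- u))) => //; rewrite ltrDl.
  apply: ub_ereal_sup => _ [k /= km <-].
  apply: (le_trans (log_coef_le k (- u) n0)); rewrite lee_fin.
  have : u * (k%:R / n%:R) <= u * (m - e).
    by rewrite ler_wpM2l ?(ltW u0)// ler_pdivrMr.
  by have := ler_norm (- A); rewrite normrN; lra.
- have ue : u * e = 1 + `|A| by rewrite /u divfK// gt_eqF.
  have u0 : 0 < u by rewrite divr_gt0// ltr_wpDr.
  have Phiu : Phi u <= M * u.
    have := @secant_le _ Phi H M 0 u PhiD; rewrite Phi0 !subr0.
    by move=> /(_ (ltW u0) (fun x _ => HM x)).
  near=> n; have n0 : (0 < n)%N by near: n; exact: nbhs_infty_gt.
  have nR0 : (0 : R) < n%:R by rewrite ltr0n.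
  have Fn : ln (Q n).[expR u] / n%:R < Phi u + 1.
    by near: n; apply: (cvgr_lt (Phi u)) => //; rewrite ltrDl.
  apply: ub_ereal_sup => _ [k /= [kM _] <-].
  apply: (le_trans (log_coef_le k u n0)); rewrite lee_fin.
  have : u * (M + e) <= u * (k%:R / n%:R).
    by rewrite ler_wpM2l ?(ltW u0)// ler_pdivlMr.
  by have := ler_norm (- A); rewrite normrN; lra.
Unshelve. all: by end_near. Qed.

(** H never goes below m, so below (m - e) n the ratio q_(k+1) / q_k exceeds
    e^(-u) for every u, in particular for u = - A, and e^A >= A.  The degree
    estimates guarantee that no denominator vanishes. *)
Lemma coef_ratio_outsideP : coef_ratio_outside P m M.
Proof.
rewrite /coef_ratio_outside; near=> e.
have e0 : 0 < e by near: e; exact: nbhs_right_gt.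
split; apply/cvgeyPge => A.
- have me : m - e < H (- A) by rewrite (lt_le_trans _ (Hm _))// gtrBl.
  near=> n; have n0 : (0 < n)%N by near: n; exact: nbhs_infty_gt.
  have dn : (m - e) * n%:R < (deg (Q n))%:R by near: n; exact: near_deg_gt me.
  have inc k : k%:R <= (m - e) * n%:R -> (Q n)`_k != 0 ->
      (Q n)`_k < (Q n)`_k.+1 * expR (- A).
    by move: k; near: n; exact: near_coef_increasing me.
  apply: le_ereal_inf_tmp => _ [k /= [lk km] <-].
  have qk : 0 < (Q n)`_k.
    apply: (pgf_support (QP n0)); rewrite low_deg_normalize ?P1// lk/=.
    by rewrite -(ler_nat R) (le_trans km)// ltW.
  rewrite -(ratio_normalize (P1 n0)) lee_fin ler_pdivlMr//.
  have : (Q n)`_k < (Q n)`_k.+1 * expR (- A).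
    by apply: inc => //; exact: lt0r_neq0.
  rewrite expRN ltr_pdivlMr ?expR_gt0// => /ltW; apply: le_trans.
  rewrite mulrC ler_wpM2l ?(ltW qk)//; have := expR_ge1Dx A; lra.
- have me : H A < M + e by rewrite (le_lt_trans (HM _))// ltrDl.
  near=> n; have n0 : (0 < n)%N by near: n; exact: nbhs_infty_gt.
  have dn : (low_deg (Q n))%:R < (M + e) * n%:R by near: n; exact: near_low_deg_lt me.
  have dec k : (M + e) * n%:R <= k%:R -> (Q n)`_k.+1 != 0 ->
      (Q n)`_k.+1 * expR A < (Q n)`_k.
    by move: k; near: n; exact: near_coef_decreasing me.
  apply: le_ereal_inf_tmp => _ [k /= [Mk kd] <-].
  have qk : 0 < (Q n)`_k.+1.
    apply: (pgf_support (QP n0)); rewrite deg_normalize ?P1// kd andbT ltnW// ltnS.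
    by rewrite -(ler_nat R) (le_trans (ltW dn)).
  rewrite -(ratio_normalize (P1 n0)) lee_fin ler_pdivlMr//.
  have : (Q n)`_k.+1 * expR A < (Q n)`_k.
    by apply: dec => //; exact: lt0r_neq0.
  move=> /ltW; apply: le_trans.
  rewrite mulrC ler_wpM2l ?(ltW qk)//; have := expR_ge1Dx A; lra.
Unshelve. all: by end_near. Qed.

Section interior.
Variable U : R -> R.
Hypothesis H_incr : forall u v, u < v -> H u < H v.
Hypothesis HU : forall a, m < a < M -> H (U a) = a.
Hypotheses (m0 : 0 <= m) (M1 : M <= 1).

Let H_mono : {mono H : u v / u < v}.
Proof. exact/leW_mono/le_mono. Qed.

(** Squeezing a0 = H(U a0) strictly between H(U a0 - d) and H(U a0 + d) leaves a
    neighbourhood of a0 on which the ratio of coefficients at k = a n and the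
    value e^(-U a) are both within a factor e^d of e^(-U a0). *)
Lemma near_saddle a0 d : m < a0 < M -> 0 < d ->
  \forall a \near a0 & n \near \oo,
   [/\ (0 < n)%N, m < a < M, U a0 - d < U a < U a0 + d &
    forall k, k%:R = a * n%:R ->
    [/\ 0 < (Q n)`_k, 0 < (Q n)`_k.+1,
        (Q n)`_k <= (Q n)`_k.+1 * expR (U a0 + d) &
        (Q n)`_k.+1 * expR (U a0 - d) <= (Q n)`_k]].
Proof.
move=> a0mM d0; have Ha0 := HU a0mM; set u0 := U a0 in Ha0 *.
have h1 : H (u0 - d) < a0 by rewrite -Ha0 H_incr// gtrBl.
have h2 : a0 < H (u0 + d) by rewrite -[ltLHS]Ha0 H_incr// ltrDl.
(* midpoints, so that both strict inequalities leave room *)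
pose b1 := (H (u0 - d) + a0) / 2; pose b2 := (a0 + H (u0 + d)) / 2.
have [hb1 b1a] : H (u0 - d) < b1 /\ b1 < a0 by rewrite /b1; split; lra.
have [hb2 b2a] : b2 < H (u0 + d) /\ a0 < b2 by rewrite /b2; split; lra.
exists ([set a | b1 < a < b2], [set n | [/\ (0 < n)%N,
  (low_deg (Q n))%:R < b1 * n%:R, b2 * n%:R < (deg (Q n))%:R,
  forall k, b1 * n%:R <= k%:R -> (Q n)`_k.+1 != 0 ->
    (Q n)`_k.+1 * expR (u0 - d) < (Q n)`_k &
  forall k, k%:R <= b2 * n%:R -> (Q n)`_k != 0 ->
    (Q n)`_k < (Q n)`_k.+1 * expR (u0 + d)]]) => /=.
  split.
    have : a0 \in `]b1, b2[ by rewrite in_itv/= b1a.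
    by move=> /near_in_itvoo; apply: filterS => x; rewrite in_itv.
  near=> n; split.
  - by near: n; exact: nbhs_infty_gt.
  - by near: n; exact: near_low_deg_lt hb1.
  - by near: n; exact: near_deg_gt hb2.
  - by near: n; exact: near_coef_decreasing hb1.
  - by near: n; exact: near_coef_increasing hb2.
move=> [a n] /= [/andP[b1a' ab2] [n0 lown degn dec inc]].
have amM : m < a < M.
  have := Hm (u0 - d); have := HM (u0 + d); move=> *; apply/andP; split; lra.
split => //.
  by apply/andP; split; rewrite -H_mono HU//; [exact: lt_trans hb1 _|exact: lt_trans ab2 _].
move=> k ka; have nR0 : (0 : R) < n%:R by rewrite ltr0n.
have b1k : b1 * n%:R <= k%:R by rewrite ka ler_wpM2r ?ltW.
have kb2 : k%:R <= b2 * n%:R by rewrite ka ler_wpM2r ?ltW.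
have lk : (low_deg (Q n) <= k)%N by rewrite -(ler_nat R) (le_trans (ltW lown)).
have kd : (k < deg (Q n))%N by rewrite -(ltr_nat R) (le_lt_trans kb2).
have qk : 0 < (Q n)`_k by apply: (pgf_support (QP n0)); rewrite lk ltnW.
have qk1 : 0 < (Q n)`_k.+1 by apply: (pgf_support (QP n0)); rewrite kd ltnW.
by split=> //; apply: ltW; [apply: inc|apply: dec] => //; exact: lt0r_neq0.
Unshelve. all: by end_near. Qed.

Lemma near_coef_ratio a0 eta : m < a0 < M -> 0 < eta ->
  \forall a \near a0 & n \near \oo, forall k, k%:R = a * n%:R ->
    `|(P n)`_k.+1 / (P n)`_k - expR (- U a)| <= eta.
Proof.
move=> a0mM eta0.
have [d [d0 hd]] : exists d, 0 < d /\ expR (- U a0 + d) - expR (- U a0 - d) <= eta.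
  have : expR x @[x --> - U a0] --> expR (- U a0) by exact: continuous_expR.
  move=> /cvgrPdist_lt/(_ (eta / 2)); rewrite divr_gt0// => /(_ isT)[r /= r0 hr].
  have r2 : 0 < r / 2 by rewrite divr_gt0.
  have rr : r / 2 < r by rewrite ltr_pdivrMr// ltr_pMr// ltr1n.
  exists (r / 2); split => //.
  have b1 : `|- U a0 - (- U a0 - r / 2)| < r.
    by rewrite (_ : _ - (_ - _) = r / 2) ?gtr0_norm//; lra.
  have b2 : `|- U a0 - (- U a0 + r / 2)| < r.
    by rewrite (_ : _ - (_ + _) = - (r / 2)) ?normrN ?gtr0_norm//; lra.
  have := hr _ b1; have := hr _ b2; rewrite /= !ltr_norml.
  move=> /andP[? ?] /andP[? ?]; lra.
apply: filterS (near_saddle a0mM d0) => -[a n] /= [n0 amM /andP[h1 h2] hk] k /hk.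
move=> [qk qk1 hinc hdec]; rewrite -(ratio_normalize (P1 n0)).
have r1 : expR (- U a0 - d) <= (Q n)`_k.+1 / (Q n)`_k.
  by rewrite ler_pdivlMr// mulrC -opprD expRN ler_pdivrMr ?expR_gt0.
have r2 : (Q n)`_k.+1 / (Q n)`_k <= expR (- U a0 + d).
  rewrite ler_pdivrMr// mulrC -[_ + d]opprK opprD opprK expRN.
  by rewrite ler_pdivlMr ?expR_gt0.
have e1 : expR (- U a0 - d) <= expR (- U a) by rewrite ler_expR; lra.
have e2 : expR (- U a) <= expR (- U a0 + d) by rewrite ler_expR; lra.
by rewrite ler_norml; apply/andP; split; lra.
Qed.

Let g a := Phi (U a) - a * U a.

(** Both log_coef and g(a) are compared with the tangent line
    Phi(U a0) - a U a0: the former by Chernoff's bound and [pgf_coef_ge] at the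
    fixed point U a0, the latter because Phi is 1-Lipschitz and U a is close to
    U a0.  Five errors, each at most d, add up to eta. *)
Lemma near_log_coef a0 eta : m < a0 < M -> 0 < eta ->
  \forall a \near a0 & n \near \oo, forall k, k%:R = a * n%:R ->
    (`|log_coef P n k - (g a)%:E| <= eta%:E)%E.
Proof.
move=> a0mM eta0; pose d := eta / 5; have d0 : 0 < d by rewrite divr_gt0.
set u0 := U a0.
have nF : \forall a \near a0 & n \near \oo,
   `|ln (Q n).[expR u0] / n%:R - Phi u0| <= d /\ ln (n.+1%:R : R) <= d * n%:R.
  exists (setT, [set n | `|ln (Q n).[expR u0] / n%:R - Phi u0| <= d /\
    ln (n.+1%:R : R) <= d * n%:R]) => /=.
    split; first exact: filterT.
    near=> n; split; last by near: n; exact: ln_succ_negligible.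
    rewrite distrC; near: n; by move: d d0; exact/cvgrPdist_le.
  by move=> [a n] [].
apply: filterS2 nF (near_saddle a0mM d0) => -[a n] /= [hF hln] [n0 amM hU hk] k ka.
have [qk qk1 hinc hdec] := hk k ka.
have nR0 : (0 : R) < n%:R by rewrite ltr0n.
rewrite log_coefE ?lt0r_neq0// -EFinB /= lee_fin.
have up : ln (Q n)`_k <= ln (Q n).[expR u0] - u0 * k%:R.
  have := log_coef_le k u0 n0; rewrite log_coefE ?lt0r_neq0// lee_fin.
  by rewrite mulrA -mulrBl ler_pM2r ?invr_gt0.
have dn : ln (Q n).[expR u0] <= ln (n.+1%:R : R) + d * n%:R + ln (Q n)`_k + u0 * k%:R.
  have d1 : 1 <= expR d by rewrite -[leLHS]expR0 ler_expR ltW.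
  have := pgf_coef_ge (QP n0) (expR_gt0 u0) d1 (lt0r_neq0 qk) (lt0r_neq0 qk1).
  rewrite -!expRN -!expRD -!expRM_natl => /(_ hinc hdec) hle.
  move: hle; rewrite -[X in is_true X -> _]ler_ln ?posrE ?mulr_gt0 ?expR_gt0
    ?(pgf_horner_gt0 (QP n0)) ?expR_gt0//.
  by rewrite !lnM ?posrE ?mulr_gt0 ?expR_gt0// !expRK; lra.
have {dn}dn : ln (Q n).[expR u0] / n%:R - 2 * d - u0 * a <= ln (Q n)`_k / n%:R.
  rewrite ler_pdivlMr// !mulrBl divfK ?lt0r_neq0// -[u0 * a * _]mulrA -ka; lra.
have {up}up : ln (Q n)`_k / n%:R <= ln (Q n).[expR u0] / n%:R - u0 * a.
  by rewrite ler_pdivrMr// mulrBl divfK ?lt0r_neq0// -mulrA -ka.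
have [g1 g2] : Phi u0 - a * u0 - 2 * d <= g a /\ g a <= Phi u0 - a * u0 + 2 * d.
  have lip u v : u <= v -> 0 <= Phi v - Phi u <= v - u.
    move=> uv; apply/andP; split.
      have := @secant_ge _ Phi H 0 u v PhiD uv; rewrite mul0r; apply => x _.
      exact: le_trans (Hm x).
    have := @secant_le _ Phi H 1 u v PhiD uv; rewrite mul1r; apply => x _.
    exact: le_trans (HM x) M1.
  move: hU; rewrite -/u0 => /andP[hU1 hU2].
  have /andP[a0' a1'] : 0 <= a <= 1.
    move: amM => /andP[ma aM].
    by rewrite (le_trans m0 (ltW ma)) (le_trans (ltW aM) M1).
  rewrite /g; case: (leP u0 (U a)) => [uU|/ltW uU]; have /andP[l1 l2] := lip _ _ uU.
    have := ler_wpM2r (_ : 0 <= U a - u0) a1'.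
    have := mulr_ge0 a0' (_ : 0 <= U a - u0).
    by rewrite subr_ge0 => /(_ uU) ? /(_ uU) ?; split; lra.
  have := ler_wpM2r (_ : 0 <= u0 - U a) a1'.
  have := mulr_ge0 a0' (_ : 0 <= u0 - U a).
  by rewrite subr_ge0 => /(_ uU) ? /(_ uU) ?; split; lra.
have etaE : eta = 5 * d by rewrite /d; lra.
move: hF; rewrite !ler_norml etaE => /andP[hF1 hF2]; apply/andP; split; lra.
Unshelve. all: by end_near. Qed.

(** Local estimates near each point of the compact interval [m + e, M - e] hold
    simultaneously for n large.  For large n the range of k is nonempty, so that
    the supremum, of nonnegative quantities, is not -oo. *)
Lemma ereal_sup_cvg0 (f : nat -> nat -> \bar R) e : 0 < e -> m + e < M - e ->
  (forall n k, (0 <= f n k)%E) ->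
  (forall a0 eta, m < a0 < M -> 0 < eta ->
    \forall a \near a0 & n \near \oo, forall k, k%:R = a * n%:R ->
      (f n k <= eta%:E)%E) ->
  ereal_sup [set f n k | k in [set k | (m + e) * n%:R <= k%:R <= (M - e) * n%:R]]
    @[n --> \oo] --> 0%E.
Proof.
move=> e0 meM f0 hf.
have unif eta : 0 < eta -> \forall n \near \oo, forall k,
    (m + e) * n%:R <= k%:R <= (M - e) * n%:R -> (f n k <= eta%:E)%E.
  move=> eta0.
  have : compact `[m + e, M - e] by exact: segment_compact.
  move=> /compact_near_coveringP/(_ _ \oo (fun n a => forall k, k%:R = a * n%:R ->
     (f n k <= eta%:E)%E)) => h.
  have {}h := h _ _; near=> n => k /andP[k1 k2].
  have n0 : (0 : R) < n%:R by near: n; exact: nbhs_infty_gtr.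
  have : `[m + e, M - e] `<=` (fun a => forall k, k%:R = a * n%:R -> (f n k <= eta%:E)%E).
    near: n; apply: h => a0; rewrite /= in_itv/= => /andP[a1 a2].
    by apply: hf => //; apply/andP; split; lra.
  move=> /(_ (k%:R / n%:R)); apply; last by rewrite divfK// gt_eqF.
  by rewrite /= in_itv/= ler_pdivlMr// k1 ler_pdivrMr.
have nonempty : \forall n \near \oo, exists k,
    (m + e) * n%:R <= k%:R <= (M - e) * n%:R.
  near=> n.
  have n0 : (0 : R) < n%:R by near: n; exact: nbhs_infty_gtr.
  have hn : ((M - e) - (m + e))^-1 < n%:R by near: n; exact: nbhs_infty_gtr.
  have me0 : 0 <= (m + e) * n%:R by rewrite mulr_ge0 ?ltW// ltr_wpDl.
  exists (Num.truncn ((m + e) * n%:R)).+1.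
  have /andP[t1 t2] := truncn_itv me0.
  rewrite (ltW t2) /= -natr1.
  rewrite -div1r ltr_pdivrMr ?subr_gt0// in hn.
  by lra.
apply/fine_cvgP; split.
  near=> n.
  have [k hk] : exists k, (m + e) * n%:R <= k%:R <= (M - e) * n%:R.
    by near: n; exact: nonempty.
  set S := ereal_sup _.
  have sup1 : (S <= 1%:E)%E.
    by apply: ub_ereal_sup => _ [j /= hj <-]; move: j hj; near: n; exact: unif.
  rewrite ge0_fin_numE ?(le_lt_trans sup1) ?ltry//.
  by apply: le_trans (f0 n k) _; apply: ereal_sup_ubound; exists k.
apply/cvgrPdist_le => eta eta0; near=> n.
have [k hk] : exists k, (m + e) * n%:R <= k%:R <= (M - e) * n%:R.
  by near: n; exact: nonempty.
rewrite /=; set S := ereal_sup _.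
have sup1 : (S <= eta%:E)%E.
  by apply: ub_ereal_sup => _ [j /= hj <-]; move: j hj; near: n; exact: unif.
have S0 : (0 <= S)%E.
  by apply: le_trans (f0 n k) _; apply: ereal_sup_ubound; exists k.
rewrite sub0r normrN ger0_norm ?fine_ge0// -lee_fin fineK//.
by rewrite ge0_fin_numE// (le_lt_trans sup1)// ltry.
Unshelve. all: by end_near. Qed.

Lemma near0_margin : m < M -> \forall e \near 0^'+, 0 < e /\ m + e < M - e.
Proof.
move=> mM; near=> e; split; first by near: e; exact: nbhs_right_gt.
have : e < (M - m) / 2.
  by near: e; apply: nbhs_right_lt; rewrite divr_gt0// subr_gt0.
lra.
Unshelve. all: by end_near. Qed.

Lemma coef_log_cvgP : m < M -> coef_log_cvg P m M g.
Proof.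
move=> /near0_margin; apply: filterS => e [e0 me].
apply: (ereal_sup_cvg0 e0 me) => [n k|a0 eta ha eta0]; first exact: abse_ge0.
have hpos : \forall a \near a0 & n \near \oo, (0 < n)%N.
  exists (setT, [set n | (0 < n)%N]); last by case=> a n [].
  by split; [exact: filterT|exact: nbhs_infty_gt].
apply: filterS2 hpos (near_log_coef ha eta0) => -[a n] /= n0 h k ka.
by have := h k ka; rewrite ka mulfK// pnatr_eq0 -lt0n.
Qed.

Lemma coef_ratio_cvgP (g' : R -> R) : m < M ->
  (forall a, m < a < M -> derive1 g' a = - U a) -> coef_ratio_cvg P m M g'.
Proof.
move=> /near0_margin h hg'; apply: filterS h => e [e0 me].
apply: (ereal_sup_cvg0 e0 me) => [n k|a0 eta ha eta0]; first by rewrite lee_fin.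
apply: filterS2 (near_saddle ha ltr01) (near_coef_ratio ha eta0) => -[a n] /=.
move=> [n0 amM _ _] h k ka.
by rewrite lee_fin ka mulfK ?pnatr_eq0 -?lt0n// hg'//; exact: h.
Qed.

End interior.
End profile.

(** * Kernels of the potential and integrals over the finite part *)

(** The mean of the Bernoulli variable attached to the zero x, after tilting its
    law by the weight e^u. *)
Definition tilt (R : realType) (u x : R) : R := expR u / (expR u - x).

Definition log_kernel (R : realType) (u x : R) : R :=
  ln ((expR u - x) / (1 - x)).

Section kernels.
Context (R : realType).
Implicit Types u x : R.

Lemma expR_sub_gt0 u x : x <= 0 -> 0 < expR u - x.
Proof. by move=> x0; have := expR_gt0 u; lra. Qed.

Lemma tilt_bounds u x : x <= 0 -> 0 < tilt u x <= 1.
Proof.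
move=> x0; have d0 := expR_sub_gt0 u x0.
rewrite /tilt divr_gt0 ?expR_gt0//= ler_pdivrMr// mul1r; lra.
Qed.

Lemma tiltX_bounds u x n : x <= 0 -> `|tilt u x ^+ n| <= 1.
Proof.
move=> x0; have /andP[t0 t1] := tilt_bounds u x0.
by rewrite normrX gtr0_norm// exprn_ile1// ltW.
Qed.

Lemma is_derive_expR_sub u x : is_derive u 1 (fun v => expR v - x) (expR u).
Proof.
apply: (is_derive_eq (is_deriveB (is_derive_expR (R:=R) u) (is_derive_cst x u (1 : R)))).
by rewrite subr0.
Qed.

(** The derivative of a logistic function. *)
Lemma is_derive_tilt u x : x <= 0 ->
  is_derive u 1 (fun v => tilt v x) (tilt u x * (1 - tilt u x)).
Proof.
move=> x0; have d0 := expR_sub_gt0 u x0; have d0' := lt0r_neq0 d0.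
have D2 := @is_deriveV R (fun v => expR v - x) u _ 1 d0' (is_derive_expR_sub u x).
apply: (is_derive_eq (is_deriveM (is_derive_expR (R:=R) u) D2)).
by rewrite /GRing.scale /= /tilt; field.
Qed.

Lemma is_derive_tiltX n u x : x <= 0 ->
  is_derive u 1 (fun v => tilt v x ^+ n)
    (n%:R * (tilt u x ^+ n - tilt u x ^+ n.+1)).
Proof.
move=> x0; have D := is_deriveX n (is_derive_tilt u x0); rewrite exprfctE in D.
apply: (is_derive_eq D); rewrite /GRing.scale /=.
by case: n {D} => [|n]; rewrite ?mul0r//= !exprS; ring.
Qed.

Lemma is_derive_log_kernel u x : x <= 0 ->
  is_derive u 1 (fun v => log_kernel v x) (tilt u x).
Proof.
move=> x0; have d0 := expR_sub_gt0 u x0; have d0' := lt0r_neq0 d0.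
have x1 : 0 < 1 - x by lra.
have D1 : is_derive u 1 (fun v => (expR v - x) * (1 - x)^-1) (expR u * (1 - x)^-1).
  apply: (is_derive_eq (is_deriveM (is_derive_expR_sub u x) (is_derive_cst ((1 - x)^-1) u 1))).
  by rewrite /GRing.scale /= mulr0 add0r mulrC.
have D2 := is_derive1_ln (divr_gt0 d0 x1).
apply: (is_derive_eq (@is_derive1_comp _ (@ln R)
  (fun v => (expR v - x) * (1 - x)^-1) u _ _ D2 D1)).
by rewrite /tilt; field; rewrite d0' lt0r_neq0.
Qed.

(** The argument of the logarithm is a convex combination of 1 and e^u. *)
Lemma log_kernel_bound u x : x <= 0 -> `|log_kernel u x| <= `|u|.
Proof.
move=> x0; have d0 := expR_sub_gt0 u x0; have x1 : 0 < 1 - x by lra.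
have q0 : 0 < (expR u - x) / (1 - x) by rewrite divr_gt0.
rewrite /log_kernel; case: (leP 0 u) => u0.
  have e1 : 1 <= expR u by rewrite -[leLHS]expR0 ler_expR.
  rewrite !ger0_norm//; last by rewrite ln_ge0// ler_pdivlMr//; lra.
  rewrite -[leRHS]expRK ler_ln ?posrE ?expR_gt0// ler_pdivrMr//.
  by have := mulr_ge0_le0 (_ : 0 <= expR u - 1) x0; rewrite subr_ge0 => /(_ e1); lra.
have e1 : expR u <= 1 by rewrite -[leRHS]expR0 ler_expR ltW.
rewrite (ltr0_norm u0) ler0_norm; last by rewrite ln_le0// ler_pdivrMr//; lra.
rewrite lerN2 -[leLHS]expRK ler_ln ?posrE ?expR_gt0// ler_pdivlMr//.
by have := mulr_ge0_le0 (_ : 0 <= 1 - expR u) x0; rewrite subr_ge0 => /(_ e1); lra.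
Qed.

Lemma continuous_tilt u x : x <= 0 -> {for x, continuous (tilt u)}.
Proof.
move=> x0; apply: continuousM; first exact: cst_continuous.
apply: continuousV; first by rewrite lt0r_neq0 ?expR_sub_gt0.
by apply: continuousB; [exact: cst_continuous|].
Qed.

Lemma continuous_tiltX n u x : x <= 0 -> {for x, continuous (fun y => tilt u y ^+ n)}.
Proof.
move=> x0; apply: (@continuous_comp _ _ _ (tilt u) (fun y => y ^+ n)).
  exact: continuous_tilt.
exact: exprn_continuous.
Qed.

Lemma continuous_log_kernel u x : x <= 0 -> {for x, continuous (log_kernel u)}.
Proof.
move=> x0; have d0 := expR_sub_gt0 u x0; have x1 : 0 < 1 - x by lra.
apply: (@continuous_comp _ _ _ (fun x => (expR u - x) / (1 - x)) (@ln R)).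
  apply: continuousM.
    by apply: continuousB; [exact: cst_continuous|].
  apply: continuousV; first by rewrite lt0r_neq0.
  by apply: continuousB; [exact: cst_continuous|].
by apply: continuous_ln; rewrite divr_gt0.
Qed.

End kernels.

Lemma nonpos_extE (R : realType) :
  nonpos_ext R = [set -oo%E] `|` nonpos_fin R.
Proof.
apply/seteqP; split => [[x||]|z] //=; rewrite /nonpos_ext /nonpos_fin /=.
- by move=> x0; right; rewrite ltNye.
- by move=> _; left.
- by case=> [->|/andP[]].
Qed.

Section finite_part.
Context (R : realType) (mu : {measure set (\bar R) -> \bar R}).
Hypothesis mu_fin : (mu (nonpos_fin R) < +oo)%E.

Lemma measurable_nonpos_fin : measurable (nonpos_fin R).
Proof.
have -> : nonpos_fin R = [set` `]-oo%E, 0%E]].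
  by apply/seteqP; split => x /=; rewrite in_itv.
exact: emeasurable_itv.
Qed.

Lemma nonpos_finP (z : \bar R) : nonpos_fin R z -> exists2 x, z = x%:E & x <= 0.
Proof.
rewrite /nonpos_fin /=; case: z => [x||] //= /andP[_]; rewrite ?lee_fin//.
by exists x.
Qed.

Lemma measurable_comp_fine (f : R -> R) :
  (forall x, x <= 0 -> {for x, continuous f}) ->
  measurable_fun (nonpos_fin R) (fun z => f (fine z)).
Proof.
move=> cf; apply: (@measurable_comp _ _ _ _ _ _ (`]-oo, 0] : set R)).
- exact: measurable_itv.
- by move=> _ [z /nonpos_finP[x -> x0] <-]; rewrite /= in_itv.
- apply: subspace_continuous_measurable_fun; first exact: measurable_itv.
  by apply: continuous_in_subspaceT => x; rewrite inE/= in_itv/=; exact: cf.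
- by apply: fine_measurable; exact: measurable_nonpos_fin.
Qed.

Lemma integrable_comp_fine (f : R -> R) (C : R) :
  (forall x, x <= 0 -> {for x, continuous f}) ->
  (forall x, x <= 0 -> `|f x| <= C) ->
  mu.-integrable (nonpos_fin R) (EFin \o (fun z => f (fine z))).
Proof.
move=> cf bf; apply: measurable_bounded_integrable => //.
- exact: measurable_nonpos_fin.
- exact: measurable_comp_fine.
- exists C; split; first exact: num_real.
  by move=> D CD z /nonpos_finP[x -> x0] /=; rewrite (le_trans (bf _ x0))// ltW.
Qed.

(** A constant dominates the derivatives, and constants are integrable since the
    mass is finite. *)
Lemma is_derive_Rintegral (f df : R -> R -> R) (C : R) (u : R) :
  (forall v x : R, x <= 0 -> is_derive v 1 (f ^~ x) (df v x)) ->
  (forall v x, x <= 0 -> `|df v x| <= C) ->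
  (forall v, mu.-integrable (nonpos_fin R) (EFin \o (fun z => f v (fine z)))) ->
  is_derive u 1 (fun v => \int[mu]_(z in nonpos_fin R) f v (fine z))
    (\int[mu]_(z in nonpos_fin R) df u (fine z)).
Proof.
move=> Df bdf intf.
have C0 : 0 <= C by rewrite (le_trans _ (bdf 0 0 (lexx _))).
have uI : `]u - 1, u + 1[%classic u.
  by rewrite /= in_itv/= gtrBl ltrDl ltr01.
have d1 v z : nonpos_fin R z ->
    partial1of2 (fun v z => f v (fine z)) v z = df v (fine z).
  move=> /nonpos_finP[x -> x0]; rewrite /partial1of2 derive1E.
  exact: (@derive_val _ _ _ _ _ _ _ (Df v x x0)).
have intC : mu.-integrable (nonpos_fin R) (EFin \o cst C).
  by apply: (@integrable_comp_fine (cst C) C) => [x _|x _];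
    [exact: cst_continuous|rewrite ger0_norm].
have intf' v : `]u - 1, u + 1[%classic v ->
  mu.-integrable (nonpos_fin R) (EFin \o (fun z => f v (fine z))) by [].
have derf v z : `]u - 1, u + 1[%classic v -> nonpos_fin R z ->
    derivable ((fun v z => f v (fine z)) ^~ z) v 1.
  by move=> _ /nonpos_finP[x -> x0]; exact: (@ex_derive _ _ _ _ _ _ _ (Df v x x0)).
have ub v z : `]u - 1, u + 1[%classic v -> nonpos_fin R z ->
    `|partial1of2 (fun v z => f v (fine z)) v z| <= cst C z.
  by move=> _ Dz; rewrite d1//; move: Dz => /nonpos_finP[x -> x0]; exact: bdf.
apply: DeriveDef.
  exact: (derivable_under_integral measurable_nonpos_fin uI intf' derf _ intC ub).
rewrite -derive1E.
rewrite (differentiation_under_integral measurable_nonpos_fin uI intf' derf _ intC ub)//.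
by apply: eq_Rintegral => z; rewrite inE => /d1.
Qed.

End finite_part.

(** * The potential and the tilted moments of the limit measure *)

(** Extends [log_kernel u] by its limit at -oo. *)
Definition log_test (R : realType) (u : R) (z : \bar R) : R :=
  if z is x%:E then log_kernel u x else 0.

(** At -oo, the argument of the logarithm is 1 + (e^u - 1) / (1 - x), which
    tends to 1. *)
Lemma continuous_log_test (R : realType) (u : R) :
  {within nonpos_ext R, continuous (log_test u)}.
Proof.
apply: continuous_in_subspaceT => z; rewrite inE; case: z => [x||] // x0.
  exact: (@continuous_log_kernel R u x x0).
have /cvgrPdist_lt h := continuous_ln (@ltr01 R).
apply/(@cvgrPdist_lt _ _ _ (nbhs (-oo%E : \bar R))) => e e0.
have [d /= d0 hd] := h e e0.
pose c := `|expR u - 1| / d.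
have c0 : 0 <= c by rewrite divr_ge0// ltW.
exists (- c); split; first exact: num_real.
case=> [x| |] //=; last by rewrite subrr normr0.
rewrite lte_fin => xc; have x1 : 0 < 1 - x by lra.
rewrite /log_kernel -ln1.
apply: hd; rewrite /ball_ /=.
have -> : 1 - (expR u - x) / (1 - x) = - ((expR u - 1) / (1 - x)).
  by field; exact: lt0r_neq0.
rewrite normrN normf_div (gtr0_norm x1) ltr_pdivrMr//.
by rewrite mulrC -ltr_pdivrMr// -/c; lra.
Qed.

Lemma measurable_log_test (R : realType) (u : R) :
  measurable_fun (nonpos_ext R) (EFin \o log_test u).
Proof.
apply/measurable_EFinP.
rewrite nonpos_extE.
apply/measurable_funU; [exact: emeasurable_set1|exact: measurable_nonpos_fin|split].
  apply: measurable_fun_set1.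
have := @measurable_comp_fine R _ (fun x => @continuous_log_kernel R u x).
by apply: eq_measurable_fun => z; rewrite inE => /nonpos_finP[x -> _].
Qed.

(** The point -oo does not contribute. *)
Lemma Rintegral_log_test (R : realType) (mu : {measure set (\bar R) -> \bar R})
    (u : R) :
  \int[mu]_(z in nonpos_ext R) log_test u z = log_potential mu (expR u).
Proof.
rewrite /log_potential Rintegral_mkcond [RHS]Rintegral_mkcond.
congr Rintegral; apply/funext => z; rewrite /patch.
have [zf|zf] := boolP (z \in nonpos_fin R).
  move: zf; rewrite inE => /nonpos_finP[x -> x0].
  by rewrite mem_set// /nonpos_ext/= lee_fin.
case: ifPn => //; rewrite inE /nonpos_ext /=.
by case: z zf => [x| |] // zf x0; case/negP: zf; rewrite inE /nonpos_fin/= ltNyr.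
Qed.

Lemma nonpos_fin_lty (R : realType) (mu : probability (\bar R) R) :
  (mu (nonpos_fin R) < +oo)%E.
Proof.
rewrite (le_lt_trans (probability_le1 mu _)) ?ltry//.
exact: measurable_nonpos_fin.
Qed.

Section masses.
Context (R : realType) (mu : probability (\bar R) R).
Hypothesis mu_nonpos : mu (nonpos_ext R) = 1%E.

Lemma nonpos_fin_mass : fine (mu (nonpos_fin R)) = mhigh mu.
Proof.
have := mu_nonpos; rewrite nonpos_extE measureU//; last 2 first.
- exact: measurable_nonpos_fin.
- by apply/seteqP; split => z //= [-> ].
rewrite /mhigh => /(congr1 fine); rewrite fineD ?fin_num_measure//; last exact: measurable_nonpos_fin.
by move=> /= <-; rewrite addrAC subrr add0r.
Qed.

(** For n = 1 this is the tilted mean H(u) = e^u G(e^u), the derivative of the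
    potential; the higher moments express its derivatives. *)
Definition tilt_moment n u : R := \int[mu]_(z in nonpos_fin R) tilt u (fine z) ^+ n.

Lemma integrable_tiltX n u :
  mu.-integrable (nonpos_fin R) (EFin \o (fun z => tilt u (fine z) ^+ n)).
Proof.
apply: (@integrable_comp_fine _ _ (nonpos_fin_lty mu) (fun x => tilt u x ^+ n) 1) => x x0.
- exact: continuous_tiltX.
- exact: tiltX_bounds.
Qed.

Lemma integrable_log_kernel u :
  mu.-integrable (nonpos_fin R) (EFin \o (fun z => log_kernel u (fine z))).
Proof.
apply: (@integrable_comp_fine _ _ (nonpos_fin_lty mu) (log_kernel u) `|u|) => x x0.
- exact: continuous_log_kernel.
- exact: log_kernel_bound.
Qed.

Lemma is_derive_log_potential (u : R) :
  is_derive u 1 (fun v => log_potential mu (expR v)) (tilt_moment 1 u).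
Proof.
have := @is_derive_Rintegral R mu (nonpos_fin_lty mu) (@log_kernel R) (fun v x => tilt v x ^+ 1) 1 u.
apply.
- by move=> v x x0; rewrite expr1; exact: is_derive_log_kernel.
- by move=> v x; exact: tiltX_bounds.
- exact: integrable_log_kernel.
Qed.

(** Moments form a family closed under differentiation, because the tilt s
    satisfies s' = s (1 - s). *)
Lemma is_derive_tilt_moment n (u : R) :
  is_derive u 1 (tilt_moment n) (n%:R * (tilt_moment n u - tilt_moment n.+1 u)).
Proof.
have -> : n%:R * (tilt_moment n u - tilt_moment n.+1 u) =
  \int[mu]_(z in nonpos_fin R)
    (n%:R * (tilt u (fine z) ^+ n - tilt u (fine z) ^+ n.+1)).
  rewrite RintegralZl ?RintegralB//; try exact: measurable_nonpos_fin;
    try exact: integrable_tiltX.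
  have := integrableB (measurable_nonpos_fin R) (integrable_tiltX n u) (integrable_tiltX n.+1 u).
  by [].
apply: (@is_derive_Rintegral R mu (nonpos_fin_lty mu) (fun v x => tilt v x ^+ n)
  (fun v x => n%:R * (tilt v x ^+ n - tilt v x ^+ n.+1)) (n%:R * 2) u).
- by move=> v x x0; exact: is_derive_tiltX.
- move=> v x x0; rewrite normrM ger0_norm// ler_wpM2l//.
  rewrite (le_trans (ler_normB _ _))//.
  by have := tiltX_bounds v n x0; have := tiltX_bounds v n.+1 x0; lra.
- exact: integrable_tiltX.
Qed.

Lemma mean_cauchy u : tilt_moment 1 u = expR u * cauchy_transform mu (expR u).
Proof.
rewrite /cauchy_transform -RintegralZl//.
- exact: measurable_nonpos_fin.
- apply: (@integrable_comp_fine _ _ (nonpos_fin_lty mu) (fun x => (expR u - x)^-1) (expR u)^-1).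
    move=> x x0; apply: continuousV; first by rewrite lt0r_neq0 ?expR_sub_gt0.
    by apply: continuousB; [exact: cst_continuous|].
  move=> x x0; have := expR_sub_gt0 u x0 => d0.
  rewrite gtr0_norm ?invr_gt0// lef_pV2 ?posrE ?expR_gt0//; lra.
Qed.

Lemma mean_le u : tilt_moment 1 u <= mhigh mu.
Proof.
rewrite -nonpos_fin_mass -[leRHS]mul1r -Rintegral_cst; last exact: measurable_nonpos_fin.
apply: le_Rintegral; first exact: measurable_nonpos_fin.
- exact: integrable_tiltX.
- apply: (@integrable_comp_fine _ _ (nonpos_fin_lty mu) (cst 1) 1) => x _.
    exact: cst_continuous.
  by rewrite normr1.
- move=> z /nonpos_finP[x -> x0] /=.
  by have /andP[_] := tilt_bounds u x0; rewrite expr1.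
Qed.

(** The tilt is 1 at the origin and positive elsewhere. *)
Lemma mean_ge u : mlow mu <= tilt_moment 1 u.
Proof.
have m0 : measurable [set 0%E : \bar R] by exact: emeasurable_set1.
have sub : [set 0%E : \bar R] `<=` nonpos_fin R.
  by move=> _ ->; rewrite /nonpos_fin/= ltNyr lexx.
rewrite /mlow -[fine _]mul1r -Rintegral_cst// /tilt_moment.
rewrite (_ : \int[mu]_(z in [set 0%E]) 1 =
  \int[mu]_(z in [set 0%E]) tilt u (fine z) ^+ 1); last first.
  apply: eq_Rintegral => z; rewrite inE => -> /=.
  by rewrite expr1 /tilt subr0 divff// lt0r_neq0// expR_gt0.
rewrite /Rintegral fine_le//.
- apply: integrable_fin_num => //.
  by apply: integrableS (integrable_tiltX 1 u) => //; exact: measurable_nonpos_fin.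
- by apply: integrable_fin_num; [exact: measurable_nonpos_fin|exact: integrable_tiltX].
- apply: ge0_subset_integral => //; first exact: measurable_nonpos_fin.
    by apply: (measurable_int mu); exact: integrable_tiltX.
  move=> z /nonpos_finP[x -> x0] /=; rewrite lee_fin expr1.
  by have /andP[/ltW] := tilt_bounds u x0.
Qed.

End masses.

(** * The range of the tilted mean *)

Lemma tilt_cvg_ninfty (R : realType) (x : R) : x <= 0 ->
  tilt (- n%:R) x @[n --> \oo] --> ((x == 0)%:R : R).
Proof.
rewrite le_eqVlt => /predU1P[->|x0].
  rewrite eqxx; apply: cvg_near_cst; apply: nearW => n.
  by rewrite /tilt subr0 divff// lt0r_neq0// expR_gt0.
rewrite lt_eqF//.
have e0 : expR (- n%:R) @[n --> \oo] --> (0 : R) := @cvgn_expR R.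
rewrite -[X in _ --> X](mul0r (0 - x)^-1); apply: cvgM => //.
apply: cvgV; first by rewrite sub0r oppr_eq0 lt_eqF.
by apply: cvgB => //; exact: cvg_cst.
Qed.

Lemma tilt_cvg_pinfty (R : realType) (x : R) : x <= 0 ->
  tilt n%:R x @[n --> \oo] --> (1 : R).
Proof.
move=> x0.
have e0 : expR (- n%:R) @[n --> \oo] --> (0 : R) := @cvgn_expR R.
have -> : (fun n => tilt (n%:R : R) x) = (fun n => (1 - x * expR (- n%:R))^-1).
  apply/funext => n; have d0 := expR_sub_gt0 n%:R x0.
  have en := expR_gt0 (n%:R : R).
  by rewrite /tilt expRN; field; rewrite !lt0r_neq0.
rewrite [X in _ --> X](_ : 1 = (1 - x * 0)^-1); last by rewrite mulr0 subr0 invr1.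
apply: cvgV; first by rewrite mulr0 subr0 oner_eq0.
exact: (cvgB (cvg_cst (1 : R)) (cvgM (cvg_cst x) e0)).
Qed.

Lemma derive_gt0_incr (R : realType) (f df : R -> R) (u v : R) :
  (forall x : R, is_derive x 1 f (df x)) -> (forall x, 0 < df x) ->
  u < v -> f u < f v.
Proof.
move=> Df df0 uv; rewrite -subr_gt0.
have [x _ ->] := @MVT _ f df u v uv (fun x _ => Df x)
  (derivable_within_continuous (fun x _ => @ex_derive _ _ _ _ _ _ _ (Df x))).
by rewrite mulr_gt0// subr_gt0.
Qed.

Section mean_range.
Context (R : realType) (mu : probability (\bar R) R).
Hypothesis mu_nonpos : mu (nonpos_ext R) = 1%E.

Let zero_sub : [set 0%E : \bar R] `<=` nonpos_fin R.
Proof. by move=> _ ->; rewrite /nonpos_fin/= ltNyr lexx. Qed.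

(** Dominated convergence, the tilts being bounded by 1. *)
Lemma mean_cvg (v : nat -> R) (L : R -> R) :
  (forall x, x <= 0 -> tilt (v n) x @[n --> \oo] --> L x) ->
  (tilt_moment mu 1 (v n))%:E @[n --> \oo] -->
    (\int[mu]_(z in nonpos_fin R) (L (fine z))%:E)%E.
Proof.
move=> vL.
have mE n : (tilt_moment mu 1 (v n))%:E =
    (\int[mu]_(z in nonpos_fin R) (tilt (v n) (fine z) ^+ 1)%:E)%E.
  rewrite /tilt_moment /Rintegral fineK//.
  by apply: integrable_fin_num; [exact: measurable_nonpos_fin|exact: integrable_tiltX].
under eq_fun do rewrite mE.
apply: (@dominated_cvg _ _ _ mu _ (measurable_nonpos_fin R)
  (fun n z => (tilt (v n) (fine z) ^+ 1)%:E) (fun z => (L (fine z))%:E)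
  (EFin \o cst 1)).
- by move=> n; apply: (measurable_int mu); exact: integrable_tiltX.
- move=> z /nonpos_finP[x -> x0] /=; apply: cvg_EFin; first exact: nearW.
  by under eq_fun do rewrite expr1; exact: vL.
- by [].
- apply: (@integrable_comp_fine _ _ (nonpos_fin_lty mu) (cst 1) 1) => x _.
    exact: cst_continuous.
  by rewrite normr1.
- move=> n z /nonpos_finP[x -> x0] /=; rewrite lee_fin; exact: tiltX_bounds.
Qed.

Lemma mean_cvg_mlow : tilt_moment mu 1 (- n%:R) @[n --> \oo] --> mlow mu.
Proof.
have m0 : measurable [set 0%E : \bar R] by exact: emeasurable_set1.
suff : (tilt_moment mu 1 (- n%:R))%:E @[n --> \oo] --> (mlow mu)%:E by move/fine_cvgP => [].
have -> : (mlow mu)%:E = (\int[mu]_(z in nonpos_fin R) ((fine z == 0)%:R)%:E)%E.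
  rewrite /mlow fineK ?fin_num_measure//.
  transitivity (mu ([set 0%E] `&` nonpos_fin R)).
    by congr (mu _); apply/esym/setIidl.
  rewrite -(integral_indic mu (measurable_nonpos_fin R))//.
  apply: eq_integral => z; rewrite inE => /nonpos_finP[x -> _].
  rewrite indicE /=; congr ((nat_of_bool _)%:R)%:E.
  apply/idP/idP; first by rewrite inE => -[->].
  by move=> /eqP ->; rewrite inE.
exact: (@mean_cvg (fun n => - n%:R) (fun x => (x == 0)%:R) (@tilt_cvg_ninfty R)).
Qed.

Lemma mean_cvg_mhigh : tilt_moment mu 1 n%:R @[n --> \oo] --> mhigh mu.
Proof.
suff : (tilt_moment mu 1 n%:R)%:E @[n --> \oo] --> (mhigh mu)%:E by move/fine_cvgP => [].
have -> : (mhigh mu)%:E = (\int[mu]_(z in nonpos_fin R) (cst 1 (fine z))%:E)%E.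
  rewrite -nonpos_fin_mass// fineK; last first.
    by rewrite fin_num_measure//; exact: measurable_nonpos_fin.
  by rewrite (integral_cst mu (measurable_nonpos_fin R) 1%E) mul1e.
exact: (@mean_cvg (fun n => n%:R) (cst 1) (@tilt_cvg_pinfty R)).
Qed.

(** The integrand s (1 - s) is positive except at the origin, and the open
    half-line has mass M - m > 0. *)
Lemma mean_variance_gt0 u : mlow mu < mhigh mu ->
  0 < tilt_moment mu 1 u - tilt_moment mu 2 u.
Proof.
move=> mM; have mD := measurable_nonpos_fin R.
have m0 : measurable [set 0%E : \bar R] by exact: emeasurable_set1.
pose f (z : \bar R) := tilt u (fine z) ^+ 1 - tilt u (fine z) ^+ 2.
have intf : mu.-integrable (nonpos_fin R) (EFin \o f).
  exact: (integrableB mD (integrable_tiltX mu 1 u) (integrable_tiltX mu 2 u)).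
have fE x : x <= 0 -> f x%:E = tilt u x * (1 - tilt u x).
  by move=> _; rewrite /f /= expr1 expr2; ring.
have f0 z : nonpos_fin R z -> 0 <= f z.
  move=> /nonpos_finP[x -> x0]; rewrite fE//.
  by have /andP[t0 t1] := tilt_bounds u x0; rewrite mulr_ge0 ?subr_ge0// ltW.
have -> : tilt_moment mu 1 u - tilt_moment mu 2 u = \int[mu]_(z in nonpos_fin R) f z.
  by rewrite /tilt_moment -RintegralB//; exact: integrable_tiltX.
rewrite lt_neqAle Rintegral_ge0// andbT; apply: contraTneq mM => int0.
rewrite -leNgt -nonpos_fin_mass//.
have : (\int[mu]_(z in nonpos_fin R) `|(f z)%:E| = 0)%E.
  have -> : (\int[mu]_(z in nonpos_fin R) `|(f z)%:E| =
             \int[mu]_(z in nonpos_fin R) (f z)%:E)%E.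
    by apply: eq_integral => z; rewrite inE => /f0 fz; rewrite gee0_abs.
  by rewrite -[LHS]fineK ?integrable_fin_num// -[fine _]int0.
move/(ae_eq_integral_abs mu mD (measurable_int mu intf)) => [N [mN N0 subN]].
have mB : measurable (nonpos_fin R `\` [set 0%E]) by exact: measurableD.
have B0 : mu (nonpos_fin R `\` [set 0%E]) = 0%E.
  apply/eqP; rewrite -measure_le0 -[leRHS]N0 le_measure ?inE//.
  move=> z [/nonpos_finP[x -> x0] /= xn0]; apply: subN => /= h.
  have := h (_ : nonpos_fin R x%:E); rewrite /nonpos_fin /= ltNyr lee_fin x0.
  have xlt0 : x < 0 by rewrite lt_neqAle x0 andbT; apply/eqP => xE; apply: xn0; rewrite xE.
  have d0 := expR_sub_gt0 u x0; have /andP[t0 _] := tilt_bounds u x0.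
  move=> /(_ isT) /= [] /eqP; rewrite fE// gt_eqF// mulr_gt0// subr_gt0.
  by rewrite /tilt ltr_pdivrMr// mul1r; lra.
have -> : mu (nonpos_fin R) = mu [set 0%E].
  have {1}-> : nonpos_fin R = [set 0%E] `|` (nonpos_fin R `\` [set 0%E]).
    by rewrite setDUK.
  rewrite measureU//; last by apply/seteqP; split => // z [-> [_ /=]]; apply.
  by rewrite -[RHS]adde0; congr adde; exact: B0.
by [].
Qed.

Lemma mean_incr u v : mlow mu < mhigh mu -> u < v ->
  tilt_moment mu 1 u < tilt_moment mu 1 v.
Proof.
move=> mM; apply: (derive_gt0_incr (fun x => is_derive_tilt_moment mu 1 x)) => x.
by rewrite mul1r mean_variance_gt0.
Qed.

Lemma mean_in u : mlow mu < mhigh mu -> mlow mu < tilt_moment mu 1 u < mhigh mu.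
Proof.
move=> mM; apply/andP; split.
  (* the weak bound, at a strictly smaller point *)
  apply: (le_lt_trans (mean_ge mu (u - 1))); apply: mean_incr => //; lra.
apply: (@lt_le_trans _ _ (tilt_moment mu 1 (u + 1))); last exact: mean_le.
by apply: mean_incr => //; lra.
Qed.

Lemma mean_surj a : mlow mu < a < mhigh mu -> exists u, tilt_moment mu 1 u = a.
Proof.
move=> /andP[ma aM].
have [n1 h1] : exists n : nat, tilt_moment mu 1 (- n%:R) < a.
  have := cvgr_lt _ mean_cvg_mlow _ ma.
  by move=> [n _ /(_ n (leqnn n))]; exists n.
have [n2 h2] : exists n : nat, a < tilt_moment mu 1 n%:R.
  have := cvgr_gt _ mean_cvg_mhigh _ aM.
  by move=> [n _ /(_ n (leqnn n))]; exists n.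
have n12 : - n1%:R <= n2%:R :> R by rewrite (@le_trans _ _ 0)// oppr_le0.
have [||u _ <-] := @IVT R (tilt_moment mu 1) (- n1%:R) n2%:R a n12.
- apply: derivable_within_continuous => x _.
  exact: (@ex_derive _ _ _ _ _ _ _ (is_derive_tilt_moment mu 1 x)).
- by apply/andP; split; [rewrite ge_min (ltW h1)|rewrite le_max (ltW h2) orbT].
- by exists u.
Qed.

End mean_range.

(** * Growth rates of normalized polynomials *)

Lemma prod_expR_sub_gt0 (R : realType) (s : seq R) (u : R) : all (<= 0) s ->
  0 < \prod_(x <- s) (expR u - x).
Proof.
move=> s0; rewrite big_seq_cond; apply: prodr_gt0 => x.
by rewrite andbT => /(allP s0); exact: expR_sub_gt0.
Qed.

Lemma prod_1_sub_gt0 (R : realType) (s : seq R) : all (<= 0) s ->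
  0 < \prod_(x <- s) (1 - x).
Proof. by move=> /(prod_expR_sub_gt0 0); rewrite expR0. Qed.

Lemma ln_prod_log_kernel (R : realType) (s : seq R) (u : R) : all (<= 0) s ->
  ln ((\prod_(x <- s) (expR u - x)) / \prod_(x <- s) (1 - x)) =
  \sum_(x <- s) log_kernel u x.
Proof.
elim: s => [|x s IH] /=; first by rewrite !big_nil divr1 ln1.
move=> /andP[x0 s0]; rewrite !big_cons -IH// /log_kernel -lnM.
- by congr ln; rewrite invfM mulrACA.
- by rewrite posrE divr_gt0 ?expR_sub_gt0//; lra.
- by rewrite posrE divr_gt0 ?prod_expR_sub_gt0 ?prod_1_sub_gt0.
Qed.

Lemma horner_scale_prod_XsubC (R : realType) (c : R) (s : seq R) (t : R) :
  (c *: \prod_(x <- s) ('X - x%:P)).[t] = c * \prod_(x <- s) (t - x).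
Proof.
rewrite hornerZ horner_prod; congr (_ * _).
by apply: eq_bigr => x _; rewrite hornerXsubC.
Qed.

Section rooted.
Context (R : realType) (n : nat) (p : {poly R}).
Hypotheses (n0 : (0 < n)%N) (p0 : p != 0) (pn : (deg p <= n)%N).
Hypothesis rp : real_nonpos_rooted p.

Lemma rooted_normalize : p.[1] != 0 /\ pgf n (normalize p).
Proof.
have [s s0 pE] := real_nonpos_rooted_factor p0 rp.
have c0 : lead_coef p != 0 by rewrite lead_coef_eq0.
have pos1 := prod_1_sub_gt0 s0.
have p1E : p.[1] = lead_coef p * \prod_(x <- s) (1 - x).
  by rewrite {1}pE horner_scale_prod_XsubC.
have p1 : p.[1] != 0 by rewrite p1E mulf_neq0// lt0r_neq0.
split => //; have [qc qa] := prod_XsubC_ratio_antitone s0.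
have cE k : (normalize p)`_k =
    (\prod_(x <- s) (1 - x))^-1 * (\prod_(x <- s) ('X - x%:P))`_k.
  by rewrite coef_normalize p1E {1}pE coefZ; field; rewrite c0 lt0r_neq0.
have i0 : 0 < (\prod_(x <- s) (1 - x))^-1 by rewrite invr_gt0.
split.
- rewrite size_scale ?invr_neq0//.
  by move: pn; rewrite /deg; case: (size p).
- by rewrite hornerZ mulVf.
- by move=> k; rewrite cE mulr_ge0// ltW.
- move=> i j ij; rewrite !cE !(mulrACA _ _ (_^-1)) ler_wpM2l ?qa//.
  by rewrite mulr_ge0// ltW.
Qed.

(** The missing degrees n - deg p, counted as zeros at -oo, contribute nothing
    because [log_test u] vanishes there. *)
Lemma ln_normalize_zero_distr u :
  ln (normalize p).[expR u] / n%:R =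
  \int[zero_distr n p]_(z in nonpos_ext R) log_test u z.
Proof.
have [s s0 pE] := real_nonpos_rooted_factor p0 rp.
have c0 : lead_coef p != 0 by rewrite lead_coef_eq0.
have pos1 := prod_1_sub_gt0 s0.
rewrite [in RHS]pE (Rintegral_zero_distr n c0 s0); last exact: measurable_log_test.
rewrite mulr0 addr0 mulrC; congr (_ * _).
rewrite -[RHS](ln_prod_log_kernel u s0); congr ln.
have hE t : p.[t] = lead_coef p * \prod_(x <- s) (t - x).
  by rewrite {1}pE horner_scale_prod_XsubC.
by rewrite hornerZ !hE; field; rewrite c0 lt0r_neq0.
Qed.

End rooted.

Section smooth_closure.
Context (R : realType) (a b : R) (U : R -> R) (S : set (R -> R)).
Hypothesis S_derive : forall F, S F -> exists2 F', S F' &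
  forall x, a < x < b -> is_derive (x : R) 1 (F \o U) (F' (U x)).

(** Each iterated derivative of f agrees, on the open interval, with a member of
    the closed family composed with U. *)
Lemma smooth_on_closed (f F : R -> R) : S F ->
  (forall x, a < x < b -> f x = F (U x)) -> smooth_on `]a, b[ f.
Proof.
move=> SF fE.
have near_in x : a < x < b -> \forall y \near x, a < y < b.
  move=> xab; have : x \in `]a, b[ by rewrite in_itv.
  by move=> /near_in_itvoo; apply: filterS => y; rewrite in_itv.
have dn (G G' : R -> R) h : (forall x, a < x < b -> h x = G (U x)) ->
    (forall x, a < x < b -> is_derive (x : R) 1 (G \o U) (G' (U x))) ->
    forall x, a < x < b -> is_derive (x : R) 1 h (G' (U x)).
  move=> hE dG x xab; apply: (near_eq_is_derive _ (dG x xab)).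
    by apply: filterS (near_in x xab) => y /hE.
have key j : exists2 G, S G & forall x, a < x < b -> derive1n j f x = G (U x).
  elim: j => [|j [G SG GE]]; first by exists F.
  have [G' SG' dG] := S_derive SG; exists G' => // x xab.
  rewrite derive1nS derive1E.
  exact: (@derive_val _ _ _ _ _ _ _ (dn _ _ _ GE dG x xab)).
move=> j x /=; rewrite in_itv/= => xab.
have [G SG GE] := key j; have [G' _ dG] := S_derive SG.
exact: (@ex_derive _ _ _ _ _ _ _ (dn _ _ _ GE dG x xab)).
Qed.

End smooth_closure.

(** * The rate function *)

(** The functions of u reachable from Phi and H by differentiating and by
    dividing by H'; composed with the inverse of H they give g and all of its
    derivatives. *)
Inductive potential_fun (R : realType) (mu : probability (\bar R) R) :
    (R -> R) -> Prop :=
| Pot_cst c : potential_fun mu (fun=> c)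
| Pot_id : potential_fun mu (fun u => u)
| Pot_log : potential_fun mu (fun u => log_potential mu (expR u))
| Pot_moment n : potential_fun mu (tilt_moment mu n)
| Pot_sub F G of potential_fun mu F & potential_fun mu G :
    potential_fun mu (fun u => F u - G u)
| Pot_mul F G of potential_fun mu F & potential_fun mu G :
    potential_fun mu (fun u => F u * G u)
| Pot_inv : potential_fun mu (fun u => (tilt_moment mu 1 u - tilt_moment mu 2 u)^-1).

(** The inverse of the tilted mean; the default value 0 is only taken outside
    its range. *)
Definition mean_inv (R : realType) (mu : probability (\bar R) R) (a : R) : R :=
  xget 0 [set u | tilt_moment mu 1 u = a].

Definition rate_fun (R : realType) (mu : probability (\bar R) R) (a : R) : R :=
  log_potential mu (expR (mean_inv mu a)) - a * mean_inv mu a.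

Section rate.
Context (R : realType) (mu : probability (\bar R) R).
Hypothesis mu_nonpos : mu (nonpos_ext R) = 1%E.
Let m := mlow mu.
Let M := mhigh mu.

Lemma mlow_ge0 : 0 <= m. Proof. by rewrite /m /mlow fine_ge0. Qed.

Lemma mhigh_le1 : M <= 1. Proof. by rewrite /M /mhigh gerBl fine_ge0. Qed.

Lemma mlow_le_mhigh : m <= M.
Proof. exact: le_trans (mean_ge mu 0) (mean_le mu_nonpos 0). Qed.

Lemma mean_invE a : m < a < M -> tilt_moment mu 1 (mean_inv mu a) = a.
Proof.
move=> aI; have [u ua] := mean_surj mu_nonpos aI.
rewrite /mean_inv; case: xgetP => [v _ va|/(_ u) nu]; first exact: va.
case: nu; exact: ua.
Qed.

Lemma log_potential0 : log_potential mu (expR 0) = 0.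
Proof.
rewrite /log_potential expR0 (@eq_Rintegral _ _ _ _ _ (cst 0)).
  by rewrite Rintegral_cst ?mul0r//; exact: measurable_nonpos_fin.
by move=> z; rewrite inE => /nonpos_finP[x -> x0]; rewrite divff ?ln1//=; lra.
Qed.

Section nondegenerate.
Hypothesis mM : m < M.

Lemma mean_mono : {mono tilt_moment mu 1 : u v / u < v}.
Proof. by apply/leW_mono/le_mono => u v; exact: mean_incr. Qed.

Lemma mean_invK u : mean_inv mu (tilt_moment mu 1 u) = u.
Proof.
have h := mean_invE (mean_in mu_nonpos u mM).
by apply/eqP; rewrite eq_le !leNgt -[_ < u]mean_mono -[u < _]mean_mono h ltxx.
Qed.

Lemma is_derive_mean (u : R) :
  is_derive u 1 (tilt_moment mu 1) (tilt_moment mu 1 u - tilt_moment mu 2 u).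
Proof. by apply: (is_derive_eq (is_derive_tilt_moment mu 1 u)); rewrite mul1r. Qed.

Lemma is_derive_mean_inv (a : R) : m < a < M ->
  is_derive a 1 (mean_inv mu)
    (tilt_moment mu 1 (mean_inv mu a) - tilt_moment mu 2 (mean_inv mu a))^-1.
Proof.
move=> aI; rewrite -{1}(mean_invE aI); set u := mean_inv mu a.
have K : {near u, cancel (tilt_moment mu 1) (mean_inv mu)} by near=> v; exact: mean_invK.
have C : {near u, continuous (tilt_moment mu 1)}.
  near=> v; apply: differentiable_continuous; apply/derivable1_diffP.
  exact: (@ex_derive _ _ _ _ _ _ _ (is_derive_mean v)).
apply: (is_derive_inverse K C (is_derive_mean u)).
by rewrite lt0r_neq0// mean_variance_gt0.
Unshelve. all: by end_near. Qed.

Lemma potential_fun_derive F : potential_fun mu F ->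
  exists2 F', potential_fun mu F' & forall u : R, is_derive u 1 F (F' u).
Proof.
elim=> {F} [c|||n|F G _ [F' SF dF] _ [G' SG dG]|F G SF [F' SF' dF] SG [G' SG' dG]|].
- by exists (fun=> 0); [exact: Pot_cst|move=> u; exact: is_derive_cst].
- by exists (fun=> 1); [exact: Pot_cst|move=> u; exact: is_derive_id].
- by exists (tilt_moment mu 1); [exact: Pot_moment|exact: is_derive_log_potential].
- exists (fun u => n%:R * (tilt_moment mu n u - tilt_moment mu n.+1 u)).
    by apply: Pot_mul; [exact: Pot_cst|apply: Pot_sub; exact: Pot_moment].
  exact: is_derive_tilt_moment.
- by exists (fun u => F' u - G' u); [exact: Pot_sub|move=> u; exact: is_deriveB].
- exists (fun u => F u * G' u - (0 - G u) * F' u).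
    apply: Pot_sub; apply: Pot_mul => //.
    by apply: Pot_sub => //; exact: Pot_cst.
  move=> u; apply: (is_derive_eq (is_deriveM (dF u) (dG u))).
  by rewrite /GRing.scale /= sub0r mulNr opprK.
- pose V u := (tilt_moment mu 1 u - tilt_moment mu 2 u)^-1.
  exists (fun u => (0 - V u * V u) *
    (1%:R * (tilt_moment mu 1 u - tilt_moment mu 2 u) -
     2%:R * (tilt_moment mu 2 u - tilt_moment mu 3 u))).
    have mm n : potential_fun mu (tilt_moment mu n) by exact: Pot_moment.
    have cc c : potential_fun mu (fun=> c) by exact: Pot_cst.
    have iv := Pot_inv mu.
    apply: (Pot_mul (Pot_sub (cc 0) (Pot_mul iv iv))
      (Pot_sub (Pot_mul (cc 1%:R) (Pot_sub (mm 1%N) (mm 2%N)))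
               (Pot_mul (cc 2%:R) (Pot_sub (mm 2%N) (mm 3%N))))).
  move=> u; have p0 := mean_variance_gt0 mu_nonpos u mM.
  apply: (is_derive_eq (@is_deriveV R
    (fun u => tilt_moment mu 1 u - tilt_moment mu 2 u) u _ 1
    (lt0r_neq0 p0) (is_deriveB (is_derive_tilt_moment mu 1 u) (is_derive_tilt_moment mu 2 u)))).
  by rewrite /GRing.scale /= /V sub0r expr2 invfM.
Qed.

Lemma potential_fun_mean_inv_derive F : potential_fun mu F ->
  exists2 F', potential_fun mu F' &
    forall a, m < a < M -> is_derive (a : R) 1 (F \o mean_inv mu) (F' (mean_inv mu a)).
Proof.
move=> /potential_fun_derive[F' SF' dF].
exists (fun u => F' u * (tilt_moment mu 1 u - tilt_moment mu 2 u)^-1).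
  by apply: Pot_mul => //; exact: Pot_inv.
by move=> a aI; exact: (is_derive1_comp (dF _) (is_derive_mean_inv aI)).
Qed.

Lemma rate_fun_smooth : smooth_on `]m, M[ (rate_fun mu).
Proof.
apply: (smooth_on_closed potential_fun_mean_inv_derive
  (F := fun u => log_potential mu (expR u) - tilt_moment mu 1 u * u)).
  apply: Pot_sub; first exact: Pot_log.
  by apply: Pot_mul; [exact: Pot_moment|exact: Pot_id].
by move=> a aI; rewrite /rate_fun mean_invE.
Qed.

Lemma derive1_rate_fun a : m < a < M -> derive1 (rate_fun mu) a = - mean_inv mu a.
Proof.
move=> aI; have dU := is_derive_mean_inv aI; set d := (X in is_derive _ _ _ X) in dU.
have dP := @is_derive1_comp R (fun u => log_potential mu (expR u)) (mean_inv mu) a _ _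
  (is_derive_log_potential mu _) dU.
have dM := is_deriveM (is_derive_id a (1 : R)) dU.
rewrite derive1E (@derive_val _ _ _ _ _ _ _ (is_deriveB dP dM)).
by rewrite /GRing.scale /= mean_invE//; ring.
Qed.

(** The function u |-> Phi(u) - a u has derivative H(u) - a, which changes sign
    only at U(a), from negative to positive: U(a) is its unique minimizer. *)
Lemma rate_fun_lt a u : m < a < M -> u != mean_inv mu a ->
  rate_fun mu a < log_potential mu (expR u) - a * u.
Proof.
move=> aI; set v := mean_inv mu a.
have df (x : R) : is_derive x 1 (fun y => log_potential mu (expR y) - a * y)
    (tilt_moment mu 1 x - a).
  have d1 := is_deriveM (is_derive_cst a x (1 : R)) (is_derive_id x (1 : R)).
  apply: (is_derive_eq (is_deriveB (is_derive_log_potential mu x) d1)).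
  by rewrite /GRing.scale /= mulr0 addr0 mulr1.
have va : tilt_moment mu 1 v = a by exact: mean_invE.
have cont x y : {within `[x, y], continuous (fun y => log_potential mu (expR y) - a * y)}.
  exact: (derivable_within_continuous (fun x _ => @ex_derive _ _ _ _ _ _ _ (df x))).
rewrite neq_lt => /orP[uv|vu].
  have [x xI E] := MVT uv (fun x _ => df x) (cont u v).
  move: xI; rewrite in_itv/= => /andP[_]; rewrite -(mean_mono x v) va => xa.
  rewrite -subr_lt0 /rate_fun -/v [X in X < _]E.
  by rewrite nmulr_rlt0 ?subr_gt0// subr_lt0.
have [x xI E] := MVT vu (fun x _ => df x) (cont v u).
move: xI; rewrite in_itv/= -(mean_mono v x) va => /andP[xa _].
rewrite -subr_gt0 /rate_fun -/v [X in _ < X]E.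
by rewrite mulr_gt0 ?subr_gt0.
Qed.

Lemma rate_fun_le a u : m < a < M ->
  rate_fun mu a <= log_potential mu (expR u) - a * u.
Proof.
move=> aI; have [->//|/(rate_fun_lt aI)/ltW//] := eqVneq u (mean_inv mu a).
Qed.

(** g is an infimum of affine functions of a, and distinct points have distinct
    minimizers, so the infimum at an intermediate point is not attained at the
    ends. *)
Lemma rate_fun_concave : strictly_concave_on `]m, M[ (rate_fun mu).
Proof.
move=> x y t /=; rewrite !in_itv/= => xI yI xy /andP[t0 t1].
set z := t * x + (1 - t) * y.
have t1' : 0 < 1 - t by rewrite subr_gt0.
have zI : m < z < M.
  move: xI yI => /andP[x1 x2] /andP[y1 y2]; rewrite /z; apply/andP; split; nra.
have xz : mean_inv mu z != mean_inv mu x.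
  apply: contra_neq xy => E.
  have zx : z = x by rewrite -(mean_invE zI) -(mean_invE xI) E.
  have : (1 - t) * (y - x) = 0 by move: zx; rewrite /z; lra.
  by move/eqP; rewrite mulf_eq0 gt_eqF//= subr_eq0 => /eqP.
have hx := rate_fun_lt xI xz; have hy := rate_fun_le (mean_inv mu z) yI.
have -> : rate_fun mu z = t * (log_potential mu (expR (mean_inv mu z)) - x * mean_inv mu z)
   + (1 - t) * (log_potential mu (expR (mean_inv mu z)) - y * mean_inv mu z).
  by rewrite /rate_fun {2}/z; ring.
by rewrite ltr_leD// ?ltr_pM2l// ler_pM2l.
Qed.

Lemma rate_fun_le0 a : m < a < M -> rate_fun mu a <= 0.
Proof.
by move=> aI; have := rate_fun_le 0 aI; rewrite log_potential0 mulr0 subr0.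
Qed.

Lemma derive1_rate_fun_cvg :
  (derive1 (rate_fun mu) x @[x --> m^'+] --> +oo) /\
  (derive1 (rate_fun mu) x @[x --> M^'-] --> -oo).
Proof.
split.
- apply/cvgryPge => A; have /andP[h1 h2] := mean_in mu_nonpos (- A) mM.
  near=> x.
  have xI : m < x < M.
    by apply/andP; split; near: x; [exact: nbhs_right_gt|exact: nbhs_right_lt].
  rewrite derive1_rate_fun// lerNr ltW// -mean_mono mean_invE//.
- apply/cvgrNyPle => A; have /andP[h1 h2] := mean_in mu_nonpos (- A) mM.
  near=> x.
  have xI : m < x < M.
    by apply/andP; split; near: x; [exact: nbhs_left_gt|exact: nbhs_left_lt].
  rewrite derive1_rate_fun// lerNl ltW// -mean_mono mean_invE//.
Unshelve. all: by end_near. Qed.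

Lemma rate_fun_inverse : inverse_on `]m, M[ `]0, +oo[
  (fun x => expR (- derive1 (rate_fun mu) x)) (fun t => t * cauchy_transform mu t).
Proof.
have hE t : 0 < t -> t * cauchy_transform mu t = tilt_moment mu 1 (ln t).
  by move=> t0; rewrite mean_cauchy lnK.
split.
- by move=> x /=; rewrite !in_itv/= expR_gt0.
- by move=> t /=; rewrite !in_itv/= andbT => t0; rewrite hE// mean_in.
- move=> x; rewrite inE/= in_itv/= => xI.
  by rewrite derive1_rate_fun// opprK hE ?expR_gt0// expRK mean_invE.
- move=> t; rewrite inE/= in_itv/= andbT => t0.
  by rewrite hE// derive1_rate_fun ?mean_in// opprK mean_invK lnK.
Qed.

Lemma rate_fun_legendre a : m < a < M ->
  (rate_fun mu a)%:E =
  ereal_inf [set (log_potential mu (expR u) - a * u)%:E | u in setT].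
Proof.
move=> aI; apply/eqP; rewrite eq_le; apply/andP; split.
  by apply: le_ereal_inf_tmp => _ [u _ <-]; rewrite lee_fin rate_fun_le.
by apply: ereal_inf_lbound; exists (mean_inv mu a).
Qed.

End nondegenerate.
End rate.

Theorem theorem2p4 (R : realType) (P : nat -> {poly R})
    (mu : probability (\bar R) R)
    (P_neq0 : forall n, (0 < n)%N -> P n != 0)
    (P_deg : forall n, (0 < n)%N -> (deg (P n) <= n)%N)
    (P_roots : forall n, (0 < n)%N -> real_nonpos_rooted (P n))
    (mu_nonpos : mu (nonpos_ext R) = 1%E)
    (P_cvg : weak_cvg (fun n => zero_distr n (P n)) mu) :
  let m := mlow mu in
  let M := mhigh mu in
  [/\ 0 <= m, m <= M & M <= 1] /\
  exists g : R -> R,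
    (* (a) *)
    ([/\ forall x, x \in `]m, M[ -> g x <= 0,
         strictly_concave_on `]m, M[ g,
         smooth_on `]m, M[ g,
         m < M -> coef_log_cvg P m M g
       & coef_log_outside P m M]) /\
    (* (b) *)
    (m < M -> inverse_on `]m, M[ `]0, +oo[
                (fun x => expR (- derive1 g x))
                (fun t => t * cauchy_transform mu t)) /\
    (* (c) *)
    (m < M -> (derive1 g x @[x --> m^'+] --> +oo) /\
              (derive1 g x @[x --> M^'-] --> -oo)) /\
    (* (d) *)
    (forall x, x \in `]m, M[ ->
       (g x)%:E = ereal_inf [set (log_potential mu (expR u) - x * u)%:E
                            | u in setT]) /\
    (* (e) *)
    (m < M -> coef_ratio_cvg P m M g) /\
    coef_ratio_outside P m M /\
    (* (f) *)
    (m = M -> coef_log_outside P m M /\ coef_ratio_outside P m M).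
Proof.
move=> m M.
have P1 n : (0 < n)%N -> (P n).[1] != 0.
  by move=> n0; have [] := rooted_normalize (P_neq0 n n0) (P_deg n n0) (P_roots n n0).
have QP n : (0 < n)%N -> pgf n (normalize (P n)).
  by move=> n0; have [] := rooted_normalize (P_neq0 n n0) (P_deg n n0) (P_roots n n0).
have Qcvg u : ln (normalize (P n)).[expR u] / n%:R @[n --> \oo] -->
    log_potential mu (expR u).
  rewrite -Rintegral_log_test; apply: cvg_trans (P_cvg _ (@continuous_log_test R u)).
  apply: near_eq_cvg; near=> n.
  have n0 : (0 < n)%N by near: n; exact: nbhs_infty_gt.
  by rewrite -ln_normalize_zero_distr//; [exact: P_neq0|exact: P_roots].
have PhiD := is_derive_log_potential mu.
have Hm := mean_ge mu; have HM := mean_le mu_nonpos.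
have logout := coef_log_outsideP QP Qcvg PhiD Hm HM (log_potential0 mu).
have ratout := coef_ratio_outsideP P1 QP Qcvg PhiD Hm HM.
have inI x : x \in `]m, M[ -> m < x < M by rewrite in_itv.
have inM x : x \in `]m, M[ -> m < M.
  by move=> /inI/andP[]; exact: lt_trans.
split; first by split; [exact: mlow_ge0|exact: mlow_le_mhigh|exact: mhigh_le1].
exists (rate_fun mu); split; last split; last split; last split; last split; last split.
- split => //.
  + by move=> x xI; apply: rate_fun_le0; [|exact: inM xI|exact: inI].
  + move=> x y t xI; have mM := inM x xI; move: x y t xI.
    exact: rate_fun_concave.
  + move=> j x xI; have mM := inM x xI; move: j x xI.
    exact: rate_fun_smooth.
  + move=> mM; apply: (coef_log_cvgP QP Qcvg PhiD Hm HM (U := mean_inv mu)) => //.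
    * by move=> u v; exact: mean_incr.
    * exact: mean_invE.
    * exact: mlow_ge0.
    * exact: mhigh_le1.
- exact: rate_fun_inverse.
- exact: derive1_rate_fun_cvg.
- by move=> x xI; apply: rate_fun_legendre; [|exact: inM xI|exact: inI].
- move=> mM; apply: (coef_ratio_cvgP P1 QP Qcvg PhiD Hm HM (U := mean_inv mu)) => //.
  * by move=> u v; exact: mean_incr.
  * exact: mean_invE.
  * exact: mlow_ge0.
  * by move=> a; exact: derive1_rate_fun.
- exact: ratout.
- by [].
Unshelve. all: by end_near. Qed.
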